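(* Let $(X,d)$ be a compact doubling metric space with $\operatorname{diam}(X,d)=1/2$ and let $\mathcal S$ be a hyperbolic filling with vertical and horizontal parameters $a,\lambda$ such that $a\ge\lambda\ge6$. Let $p>0$. There exists $\eta_0\in(0,1)$, depending only on $p$, $\lambda$ and the doubling constant of $(X,d)$ (but not on $a$), such that if there is a function $\sigma:\mathcal S\to[0,\infty)$ satisfying (S1) for all $k\ge0$, all $v\in\mathcal S_k$ and all $\gamma\in\Gamma_k(v)$, $\sum_{w\in\gamma}\sigma(w)\ge1$; and (S2) for all $k\ge0$ and all $v\in\mathcal S_k$, $\sum_{w\in C(v)}\sigma(w)^p\le\eta_0$, then there exists $\Theta\in\mathcal J_p(X,d)$ (in particular $\Theta\in\mathcal J(X,d)$) with $\dim_{\mathrm A}(X,\Theta)\le p$. In particular $\dim_{\mathrm{CA}}(X,d)\le\inf\{\dim_{\mathrm A}(X,\theta):\theta\in\mathcal J_p(X,d)\}\le p$.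
   Context: Hyperbolic filling: $(X,d)$ compact with $\operatorname{diam}=1/2$, $a,\lambda>1$; $X_0\subset X_1\subset\cdots$ increasing, each $X_n$ a maximal $a^{-n}$-separated subset of $X$. $\mathcal S_n=\{(x,n):x\in X_n\}$, $\mathcal S=\bigcup_n\mathcal S_n$, $\pi_1(x,n)=x$, $\pi_2(x,n)=n$, $B_v=B(\pi_1(v),a^{-\pi_2(v)})$. Each $(x,n)$, $n\ge1$, has a fixed parent $(y,n-1)$ with $d(x,y)=\min_{z\in X_{n-1}}d(x,z)$; $C(v)$ is the set of children of $v$. The graph $(\mathcal S,D_2)$ has edges between each vertex and its parent, and horizontal edges between distinct $(x,n),(y,n)$ with $B(x,\lambda a^{-n})\cap B(y,\lambda a^{-n})\ne\emptyset$. A horizontal path is a finite sequence of vertices consecutive ones joined by horizontal edges. For $v\in\mathcal S_k$, $\Gamma_k(v)$ is the set of horizontal paths $(v_1,\dots,v_n)$ with all $v_i\in\mathcal S_{k+1}$, $\pi_1(v_1)\in B_v$ and $\pi_1(v_n)\notin B(\pi_1(v),2a^{-k})$. Doubling: every ball of radius $r$ is covered by $N$ balls of radius $r/2$ ($N$ the doubling constant). Assouad dimension $\dim_{\mathrm A}(X,\theta)=\inf\{\beta:\exists C,\ N_r(B(x,R))\le C(R/r)^\beta\ \forall x,0<r<R\}$. $\mathcal J(X,d)$: metrics $\theta$ with $\theta(x,a)/\theta(x,b)\le\eta(d(x,a)/d(x,b))$ for a homeomorphism $\eta$ of $[0,\infty)$; $\mathcal J_p(X,d)$: those for which $\eta(t)=C(t^\alpha\vee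 t^{1/\alpha})$, $C,\alpha\ge1$. $\dim_{\mathrm{CA}}(X,d)=\inf\{\dim_{\mathrm A}(X,\theta):\theta\in\mathcal J(X,d)\}$. *)

(* Defs.v *)
From Stdlib Require Import Reals Lra List.
Open Scope R_scope.

Section Defs.
Context {X : Type}.

Record is_metric (d : X -> X -> R) : Prop := {
  met_nonneg : forall x y, 0 <= d x y;
  met_zero : forall x y, d x y = 0 <-> x = y;
  met_sym : forall x y, d x y = d y x;
  met_tri : forall x y z, d x z <= d x y + d y z }.

Definition ball (d : X -> X -> R) (x : X) (r : R) : X -> Prop :=
  fun y => d x y < r.

Definition is_open (d : X -> X -> R) (U : X -> Prop) : Prop :=
  forall x, U x -> exists r, 0 < r /\ forall y, ball d x r y -> U y.

Definition compact_metric (d : X -> X -> R) : Prop :=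
  forall (I : Type) (U : I -> X -> Prop),
    (forall i, is_open d (U i)) -> (forall x, exists i, U i x) ->
    exists l : list I, forall x, exists i, In i l /\ U i x.

Definition doubling_with (d : X -> X -> R) (N : nat) : Prop :=
  forall x r, exists l : list X, (length l <= N)%nat /\
    forall y, ball d x r y -> exists z, In z l /\ ball d z (r / 2) y.

Definition diam_eq (d : X -> X -> R) (D : R) : Prop :=
  is_lub (fun t => exists x y, t = d x y) D.

Definition separated (d : X -> X -> R) (A : X -> Prop) (eps : R) : Prop :=
  forall x y, A x -> A y -> x <> y -> eps <= d x y.

Definition maximal_separated (d : X -> X -> R) (A : X -> Prop) (eps : R) : Prop :=
  separated d A eps /\
  forall B : X -> Prop, (forall x, A x -> B x) -> separated d B eps ->
    forall x, B x -> A x.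

(* Hyperbolic filling data: Xn n is the set X_n; the vertex (x,n) has parent
   (par x n, n-1) for n >= 1. *)
Record hyperbolic_filling (d : X -> X -> R) (a : R) (Xn : nat -> X -> Prop)
    (par : X -> nat -> X) : Prop := {
  hf_incl : forall n x, Xn n x -> Xn (S n) x;
  hf_max : forall n, maximal_separated d (Xn n) (/ a ^ n);
  hf_par_in : forall n x, Xn (S n) x -> Xn n (par x (S n));
  hf_par_min : forall n x z, Xn (S n) x -> Xn n z -> d x (par x (S n)) <= d x z }.

Definition hedge (d : X -> X -> R) (a lam : R) (n : nat) (x y : X) : Prop :=
  x <> y /\ exists z, ball d x (lam / a ^ n) z /\ ball d y (lam / a ^ n) z.

Fixpoint chain (P : X -> X -> Prop) (x : X) (l : list X) : Prop :=
  match l with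
  | nil => True
  | y :: l' => P x y /\ chain P y l'
  end.

(* g is (the list of first coordinates of) a path in Gamma_k(v), v = (y,k) *)
Definition in_Gamma (d : X -> X -> R) (a lam : R) (Xn : nat -> X -> Prop)
    (k : nat) (y : X) (g : list X) : Prop :=
  exists x0 l, g = x0 :: l /\ Forall (Xn (S k)) g /\
    chain (hedge d a lam (S k)) x0 l /\
    ball d y (/ a ^ k) x0 /\ ~ ball d y (2 / a ^ k) (last l x0).

End Defs.

(* t^y for t >= 0 (with 0^y = 0, y > 0) *)
Definition pw (t y : R) : R := if Rle_dec t 0 then 0 else Rpower t y.

Section Defs2.
Context {X : Type}.

Definition S1_cond (d : X -> X -> R) (a lam : R) (Xn : nat -> X -> Prop)
    (sigma : X -> nat -> R) : Prop :=
  forall k y g, Xn k y -> in_Gamma d a lam Xn k y g ->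
    1 <= fold_right (fun x s => sigma x (S k) + s) 0 g.

(* sum over the (finite) set C(v) of sigma^p, bounded by eta0: every finite
   sub-sum of these nonnegative terms is <= eta0 *)
Definition S2_cond (Xn : nat -> X -> Prop) (par : X -> nat -> X)
    (sigma : X -> nat -> R) (p eta0 : R) : Prop :=
  forall k y, Xn k y -> forall l : list X, NoDup l ->
    (forall x, In x l -> Xn (S k) x /\ par x (S k) = y) ->
    fold_right (fun x s => pw (sigma x (S k)) p + s) 0 l <= eta0.

Definition eta_pow (C al t : R) : R := C * Rmax (pw t al) (pw t (/ al)).

Definition in_Jp (d th : X -> X -> R) : Prop :=
  is_metric th /\ exists C al, 1 <= C /\ 1 <= al /\
    forall x y z, z <> x -> th x y / th x z <= eta_pow C al (d x y / d x z).

Definition cont_on_nonneg (f : R -> R) : Prop :=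
  forall t eps, 0 <= t -> 0 < eps -> exists del, 0 < del /\
    forall s, 0 <= s -> Rabs (s - t) < del -> Rabs (f s - f t) < eps.

Definition homeo_nonneg (f : R -> R) : Prop :=
  exists g : R -> R,
    (forall t, 0 <= t -> 0 <= f t) /\ (forall t, 0 <= t -> 0 <= g t) /\
    (forall t, 0 <= t -> g (f t) = t) /\ (forall t, 0 <= t -> f (g t) = t) /\
    cont_on_nonneg f /\ cont_on_nonneg g.

Definition in_J (d th : X -> X -> R) : Prop :=
  is_metric th /\ exists eta, homeo_nonneg eta /\
    forall x y z, z <> x -> th x y / th x z <= eta (d x y / d x z).

(* beta belongs to the set whose infimum is dim_A(X,th):
   exists C, N_r(B(x,R)) <= C (R/r)^beta for all x, 0<r<R, where
   N_r(E) is the least number of th-balls of radius r covering E *)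
Definition assouad_bound (th : X -> X -> R) (beta : R) : Prop :=
  exists C, forall x r RR, 0 < r -> r < RR ->
    exists l : list X, INR (length l) <= C * Rpower (RR / r) beta /\
      forall y, ball th x RR y -> exists z, In z l /\ ball th z r y.

Definition assouad_le (th : X -> X -> R) (p : R) : Prop :=
  forall eps, 0 < eps -> exists beta, beta < p + eps /\ assouad_bound th beta.

Definition dimCA_le (d : X -> X -> R) (p : R) : Prop :=
  forall eps, 0 < eps -> exists th, in_J d th /\
    exists beta, beta < p + eps /\ assouad_bound th beta.

Definition infJp_le (d : X -> X -> R) (p : R) : Prop :=
  forall eps, 0 < eps -> exists th, in_Jp d th /\
    exists beta, beta < p + eps /\ assouad_bound th beta.

End Defs2.

(* Main.v *)
(** Idea.  From [sigma] we build weights [wt k] on the vertices of level [k], to be the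
    [Theta]-size of the ball [B_v].  A child [w] of level [k+1] must weigh at least
    [sigma w * wt k u] for every vertex [u] such that a path of [Gamma_k(u)] may use [w];
    it also weighs at least [eps] times its parent, and [eps] times what is required of
    its horizontal neighbours.  This makes horizontal neighbours comparable with the
    constant [1/eps] on all levels, and (S2) with small [eta0] gives that the sum of
    [wt^p] over a region of level [k+1] is at most half the sum over a slightly larger
    region of level [k]; as the enlargements form a geometric series, the weights decay
    exponentially and the [p]-mass below a vertex [v] is at most a constant times
    [wt v ^ p].

    [Theta x y] is the infimum of the total weight of chains of balls of mixed levels
    from [x] to [y].  By (S1) a piece of a chain running through level [n+1] and leaving a
    ball of level [n] may be replaced by the centre of that ball without increasing the
    total weight, and a piece which does not leave it only displaces the end points by
    [O(a^-n)].  Removing the finest levels one after the other bounds [Theta x y] from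
    below by the weight of a vertex near [x] of level [k], where [a^-k] is comparable to
    [d x y].  Hence [Theta x y] is comparable to that weight: exponential decay gives
    power quasisymmetry, and counting, on all levels, the vertices of weight comparable to
    [r] in a ball by their [p]-mass gives the Assouad bound with exponent [p]. *)

Require Import Defs.
From Stdlib Require Import Reals Lra Lia List Classical ClassicalEpsilon.
Open Scope R_scope.

(** * Powers and finite sums *)

Lemma pw_pos t y : 0 < t -> pw t y = Rpower t y.
Proof. intros; unfold pw; destruct (Rle_dec t 0); lra. Qed.

Lemma pw_nonpos t y : t <= 0 -> pw t y = 0.
Proof. intros; unfold pw; destruct (Rle_dec t 0); lra. Qed.

Lemma pw_gt0 t y : 0 < t -> 0 < pw t y.
Proof. intros; rewrite pw_pos by lra; apply exp_pos. Qed.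

Lemma pw_ge0 t y : 0 <= pw t y.
Proof.
destruct (Rle_dec t 0); [rewrite pw_nonpos; lra | apply Rlt_le, pw_gt0; lra].
Qed.

Lemma pw_mult s t y : 0 <= s -> 0 <= t -> pw (s * t) y = pw s y * pw t y.
Proof.
intros [Hs | <-] [Ht | <-]; rewrite ?Rmult_0_l, ?Rmult_0_r, ?(pw_nonpos 0), ?Rmult_0_l,
  ?Rmult_0_r by lra; try easy.
assert (0 < s * t) by nra.
rewrite !pw_pos by easy; symmetry; now apply Rpower_mult_distr.
Qed.

Lemma pw_le s t y : 0 <= y -> s <= t -> pw s y <= pw t y.
Proof.
intros Hy Hst; destruct (Rle_dec s 0) as [Hs | Hs].
- rewrite (pw_nonpos s) by easy; apply pw_ge0.
- rewrite !pw_pos by lra; apply Rle_Rpower_l; lra.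
Qed.

Lemma pw_lt s t y : 0 < y -> 0 <= s < t -> pw s y < pw t y.
Proof.
intros Hy Hst; destruct (Rle_dec s 0) as [Hs | Hs].
- rewrite (pw_nonpos s) by easy; apply pw_gt0; lra.
- rewrite !pw_pos by lra; apply Rlt_Rpower_l; lra.
Qed.

Lemma pw_1 y : pw 1 y = 1.
Proof. rewrite pw_pos by lra; unfold Rpower; rewrite ln_1, Rmult_0_r; apply exp_0. Qed.

Lemma pw_pw t y z : pw (pw t y) z = pw t (y * z).
Proof.
destruct (Rle_dec t 0).
- rewrite !(pw_nonpos t) by easy; apply pw_nonpos; lra.
- rewrite !(pw_pos t) by lra; rewrite pw_pos by apply exp_pos; apply Rpower_mult.
Qed.

Lemma pw_id t : 0 <= t -> pw t 1 = t.
Proof.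
intros [Ht | <-]; [rewrite pw_pos by easy; now apply Rpower_1 | apply pw_nonpos; lra].
Qed.

Lemma pw_pow_l t y n : 0 < t -> pw (t ^ n) y = pw t y ^ n.
Proof.
intros Ht; induction n as [|n IH]; simpl; [apply pw_1|].
rewrite pw_mult, IH; try easy; try lra; apply pow_le; lra.
Qed.

Lemma pw_max s t y : 0 <= y -> pw (Rmax s t) y <= pw s y + pw t y.
Proof.
intros Hy; pose proof (pw_ge0 s y); pose proof (pw_ge0 t y).
unfold Rmax; destruct (Rle_dec s t); lra.
Qed.

Fixpoint sum {A : Type} (l : list A) (f : A -> R) : R :=
  match l with nil => 0 | x :: l' => f x + sum l' f end.

Lemma sum_fold_right {A : Type} (l : list A) (f : A -> R) :
  fold_right (fun x s => f x + s) 0 l = sum l f.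
Proof. induction l as [|x l IH]; simpl; congruence. Qed.

Definition ind (P : Prop) : R := if excluded_middle_informative P then 1 else 0.

Lemma ind_true P : P -> ind P = 1.
Proof. unfold ind; destruct (excluded_middle_informative P); easy. Qed.

Lemma ind_false P : ~ P -> ind P = 0.
Proof. unfold ind; destruct (excluded_middle_informative P); easy. Qed.

Lemma ind_bounds P : 0 <= ind P <= 1.
Proof. unfold ind; destruct (excluded_middle_informative P); lra. Qed.

Section Sums.
Context {A : Type}.
Implicit Types (l : list A) (f g : A -> R).

Lemma sum_le l f g : (forall x, In x l -> f x <= g x) -> sum l f <= sum l g.
Proof.
induction l as [|x l IH]; simpl; intros H; [lra|].
apply Rplus_le_compat; auto.
Qed.

Lemma sum_ext l f g : (forall x, In x l -> f x = g x) -> sum l f = sum l g.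
Proof. intros H; apply Rle_antisym; apply sum_le; intros x Hx; rewrite (H x Hx); lra. Qed.

Lemma sum_0 l : sum l (fun _ => 0) = 0.
Proof. induction l; simpl; lra. Qed.

Lemma sum_ge0 l f : (forall x, In x l -> 0 <= f x) -> 0 <= sum l f.
Proof. intros H; rewrite <- (sum_0 l); now apply sum_le. Qed.

Lemma sum_plus l f g : sum l (fun x => f x + g x) = sum l f + sum l g.
Proof. induction l; simpl; lra. Qed.

Lemma sum_scal l f c : sum l (fun x => c * f x) = c * sum l f.
Proof. induction l as [|x l IH]; simpl; [ring | rewrite IH; ring]. Qed.

Lemma sum_const l c : sum l (fun _ => c) = INR (length l) * c.
Proof.
induction l as [|x l IH]; [simpl; ring|].
cbn [length sum]; rewrite S_INR, IH; ring.
Qed.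

Lemma sum_app l l' f : sum (l ++ l') f = sum l f + sum l' f.
Proof. induction l; simpl; lra. Qed.

Lemma sum_term l f x : (forall y, In y l -> 0 <= f y) -> In x l -> f x <= sum l f.
Proof.
induction l as [|y l IH]; simpl; intros Hf []; subst.
- pose proof (sum_ge0 l f ltac:(auto)); lra.
- specialize (IH ltac:(auto) H); pose proof (Hf y ltac:(auto)); lra.
Qed.

(** Classical indicators take the place of [filter], as the predicates in use are not decidable;
    [l'] is the sublist on which [Q] holds. *)
Lemma sum_ind_eq l (Q : A -> Prop) f :
  exists l', sum l (fun x => ind (Q x) * f x) = sum l' f /\ (NoDup l -> NoDup l') /\
    forall x, In x l' <-> In x l /\ Q x.
Proof.
induction l as [|x l (l' & E & N & H)]; simpl; [now exists nil|].
destruct (classic (Q x)) as [Hx | Hx].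
- exists (x :: l'); rewrite ind_true, E by easy; split; [simpl; ring|split].
  + intros HN; inversion HN; subst; constructor; auto; rewrite H; tauto.
  + intros y; simpl; rewrite H; intuition (subst; auto).
- exists l'; rewrite ind_false, E by easy; split; [simpl; ring|split].
  + intros HN; inversion HN; auto.
  + intros y; rewrite H; intuition (subst; tauto).
Qed.

Lemma sum_ind_le l (Q : A -> Prop) f c : NoDup l ->
  (forall l', NoDup l' -> (forall x, In x l' -> In x l /\ Q x) -> sum l' f <= c) ->
  sum l (fun x => ind (Q x) * f x) <= c.
Proof.
intros N H; destruct (sum_ind_eq l Q f) as (l' & -> & N' & H').
apply H; auto; apply H'.
Qed.

Fixpoint lmax l f : R :=
  match l with nil => 0 | x :: l' => Rmax (f x) (lmax l' f) end.

Lemma lmax_ge0 l f : 0 <= lmax l f.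
Proof. induction l; simpl; [lra | eapply Rle_trans; [eassumption | apply Rmax_r]]. Qed.

Lemma lmax_ge l f x : In x l -> f x <= lmax l f.
Proof.
induction l as [|y l IH]; simpl; [easy|]; intros [<- | H]; [apply Rmax_l|].
eapply Rle_trans; [now apply IH | apply Rmax_r].
Qed.

Lemma lmax_le l f c : 0 <= c -> (forall x, In x l -> f x <= c) -> lmax l f <= c.
Proof. intros Hc; induction l; simpl; intros H; [easy | apply Rmax_lub; auto]. Qed.

(** This is why the weights are built from maxima: passing to powers costs no constant, for
    exponents below 1 as well as above. *)
Lemma pw_lmax l f y : 0 <= y -> pw (lmax l f) y <= sum l (fun x => pw (f x) y).
Proof.
intros Hy; induction l as [|x l IH]; simpl; [rewrite pw_nonpos; lra|].
pose proof (pw_max (f x) (lmax l f) y Hy); lra.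
Qed.

Lemma finite_enum (Q : A -> Prop) b :
  (forall l, NoDup l -> (forall x, In x l -> Q x) -> (length l <= b)%nat) ->
  exists l, NoDup l /\ forall x, In x l <-> Q x.
Proof.
intros Hb.
assert (H : forall n l, NoDup l -> (forall x, In x l -> Q x) -> (b <= length l + n)%nat ->
  exists l', NoDup l' /\ forall x, In x l' <-> Q x).
{ induction n as [|n IH]; intros l N Hl Hn.
  - exists l; split; auto; intros x; split; auto; intros Hx.
    apply NNPP; intros Hxl.
    assert (length (x :: l) <= b)%nat by
      (apply Hb; [now constructor | intros y [<- | ]; auto]).
    simpl in *; lia.
  - destruct (classic (forall x, Q x -> In x l)) as [Hc | Hc].
    + exists l; split; auto; intros x; split; auto.
    + apply not_all_ex_not in Hc as [x Hx].
      apply imply_to_and in Hx as [Hx Hxl].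
      apply (IH (x :: l)); [now constructor | intros y [<- | ]; auto | simpl; lia]. }
apply (H b nil); [constructor | easy | simpl; lia].
Qed.

End Sums.

Lemma sum_swap {A B : Type} (l : list A) (l' : list B) (f : A -> B -> R) :
  sum l (fun x => sum l' (f x)) = sum l' (fun y => sum l (fun x => f x y)).
Proof.
induction l as [|x l IH]; simpl; [now rewrite sum_0|].
now rewrite IH, <- sum_plus.
Qed.

Lemma sum_fiber {A B : Type} (l : list A) (l' : list B) (h : A -> B) (f : A -> R) :
  (forall x, In x l -> 0 <= f x) -> (forall x, In x l -> In (h x) l') ->
  sum l f <= sum l' (fun y => sum l (fun x => ind (h x = y) * f x)).
Proof.
intros Hf Hh; rewrite <- sum_swap; apply sum_le; intros x Hx.
rewrite <- (Rmult_1_l (f x)) at 1; rewrite <- (ind_true (h x = h x)) by easy.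
apply (sum_term l' (fun y => ind (h x = y) * f x)); auto.
intros y _; apply Rmult_le_pos; auto; apply ind_bounds.
Qed.

(** * Hyperbolic fillings *)

Section Doubling.
Context {X : Type} {d : X -> X -> R} {N : nat}.
Context (Hd : is_metric d) (HN : doubling_with d N).

Lemma doubling_iter j x r : exists l : list X, (length l <= N ^ j)%nat /\
  forall y, ball d x r y -> exists z, In z l /\ ball d z (r / 2 ^ j) y.
Proof.
revert x r; induction j as [|j IH]; intros x r.
- exists (x :: nil); split; [simpl; lia|]; intros y Hy; exists x; split; [now left|].
  simpl; now replace (r / 1) with r by field.
- destruct (HN x r) as (l & Hl & Hcov).
  assert (H : exists l', (length l' <= length l * N ^ j)%nat /\
    forall z y, In z l -> ball d z (r / 2) y ->
      exists w, In w l' /\ ball d w (r / 2 ^ S j) y).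
  { clear Hl Hcov; induction l as [|z l (l' & Hl' & H')]; [now exists nil|].
    destruct (IH z (r / 2)) as (m & Hm & Hcm).
    exists (m ++ l'); split; [rewrite length_app; simpl; lia|].
    intros z' y [<- | Hz] Hy.
    - destruct (Hcm y Hy) as (w & Hw & Hwy); exists w; split; [apply in_app_iff; auto|].
      replace (r / 2 ^ S j) with (r / 2 / 2 ^ j); auto.
      simpl; field; apply pow_nonzero; lra.
    - destruct (H' z' y Hz Hy) as (w & Hw & Hwy); exists w; split; auto.
      apply in_app_iff; auto. }
  destruct H as (l' & Hl' & H'); exists l'; split.
  + apply (Nat.le_trans _ _ _ Hl'); simpl; now apply Nat.mul_le_mono_r.
  + intros y Hy; destruct (Hcov y Hy) as (z & Hz & Hzy); eauto.
Qed.

(** Send each point to the centre of a ball of the iterated cover containing it. Two points with the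
    same centre would be at distance less than [eps], so this map is injective. *)
Lemma separated_packing (Q : X -> Prop) eps j x r l :
  separated d Q eps -> r <= 2 ^ j * (eps / 2) -> NoDup l ->
  (forall y, In y l -> Q y /\ d y x < r) -> (length l <= N ^ j)%nat.
Proof.
intros Hsep Hr Hnd Hl.
destruct (doubling_iter j x r) as (c & Hc & Hcov).
assert (Hh : forall y, exists z, In y l -> In z c /\ ball d z (r / 2 ^ j) y).
{ intros y; destruct (classic (In y l)) as [Hy | Hy]; [|now exists y].
  destruct (Hcov y) as (z & Hz); [|now exists z].
  unfold ball; rewrite (met_sym d Hd); now apply Hl. }
apply choice in Hh as [h Hh].
assert (Hinj : NoDup (map h l)).
{ apply NoDup_map_NoDup_ForallPairs; auto.
  intros y y' Hy Hy' E; apply NNPP; intros Hne.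
  destruct (Hh y Hy) as [_ H1]; destruct (Hh y' Hy') as [_ H2].
  rewrite <- E in H2; unfold ball in *.
  pose proof (Hsep y y' (proj1 (Hl y Hy)) (proj1 (Hl y' Hy')) Hne).
  pose proof (met_tri d Hd y (h y) y'); rewrite (met_sym d Hd y (h y)) in H0.
  assert (r / 2 ^ j <= eps / 2).
  { apply Rmult_le_reg_l with (2 ^ j); [apply pow_lt; lra|].
    replace (2 ^ j * (r / 2 ^ j)) with r; auto; field; apply pow_nonzero; lra. }
  lra. }
rewrite <- (length_map h l); transitivity (length c); auto.
apply NoDup_incl_length; auto.
intros z Hz; apply in_map_iff in Hz as (y & <- & Hy); now apply Hh.
Qed.

End Doubling.

Section Filling.
Context {X : Type} {d : X -> X -> R} {N : nat} {a lam : R}.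
Context {Xn : nat -> X -> Prop} {par : X -> nat -> X}.
Context (Hd : is_metric d) (HN : doubling_with d N) (Hdiam : diam_eq d (1 / 2)).
Context (Hlam : 6 <= lam) (Ha : lam <= a) (HX : hyperbolic_filling d a Xn par).

Local Notation sc n := (/ a ^ n).

Lemma sc_pos n : 0 < sc n.
Proof. apply Rinv_0_lt_compat, pow_lt; lra. Qed.

Lemma sc_S n : sc n = a * sc (S n).
Proof. simpl; field; split; [apply pow_nonzero|]; lra. Qed.

Lemma sc_lam n : lam * sc (S n) <= sc n.
Proof. rewrite (sc_S n); pose proof (sc_pos (S n)); nra. Qed.

Lemma sc_6 n : 6 * sc (S n) <= sc n.
Proof. rewrite (sc_S n); pose proof (sc_pos (S n)); nra. Qed.

Lemma sc_decr n m : (n <= m)%nat -> sc m <= sc n.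
Proof.
induction 1 as [|m _ IH]; [lra|].
pose proof (sc_6 m); pose proof (sc_pos (S m)); lra.
Qed.

Lemma dist_refl x : d x x = 0.
Proof. now apply (met_zero d Hd). Qed.

Lemma dist_le_half x y : d x y <= 1 / 2.
Proof. apply Hdiam; eauto. Qed.

Lemma net_cover n x : exists z, Xn n z /\ d z x < sc n.
Proof.
apply NNPP; intros Hno.
assert (Hfar : forall z, Xn n z -> sc n <= d z x)
  by (intros z Hz; apply Rnot_lt_le; intros Hzx; apply Hno; eauto).
destruct (hf_max _ _ _ _ HX n) as [Hsep Hmax].
apply Hno; exists x; split; [|rewrite dist_refl; apply sc_pos].
apply (Hmax (fun y => Xn n y \/ y = x)); auto.
intros y z [Hy | ->] [Hz | ->] Hyz; auto; try easy.
rewrite (met_sym d Hd); auto.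
Qed.

Lemma par_in n x : Xn (S n) x -> Xn n (par x (S n)).
Proof. apply (hf_par_in _ _ _ _ HX). Qed.

Lemma par_near n x : Xn (S n) x -> d (par x (S n)) x < sc n.
Proof.
intros Hx; destruct (net_cover n x) as (z & Hz & Hzx).
rewrite (met_sym d Hd) in *.
pose proof (hf_par_min _ _ _ _ HX n x z Hx Hz); lra.
Qed.

Lemma net_packing j n x r l :
  r <= 2 ^ j * (sc n / 2) -> NoDup l -> (forall y, In y l -> Xn n y /\ d y x < r) ->
  (length l <= N ^ j)%nat.
Proof. apply separated_packing; auto; apply (hf_max _ _ _ _ HX). Qed.

Lemma net_packing_R j n x r l :
  r <= 2 ^ j * (sc n / 2) -> NoDup l -> (forall y, In y l -> Xn n y /\ d y x < r) ->
  INR (length l) <= INR (N ^ j).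
Proof. intros; apply le_INR; eapply net_packing; eassumption. Qed.

Lemma space_inhabited : exists x : X, True.
Proof.
apply NNPP; intros Hno.
assert (1 / 2 <= 0); [|lra].
apply Hdiam; intros t (x & _); exfalso; eauto.
Qed.

Lemma net_enum : exists L : nat -> list X, forall n, NoDup (L n) /\ forall x, In x (L n) <-> Xn n x.
Proof.
apply (choice (fun n l => NoDup l /\ forall x, In x l <-> Xn n x)); intros n.
destruct space_inhabited as [x0 _].
destruct (Pow_x_infinity 2 ltac:(rewrite Rabs_right; lra) (2 * a ^ n)) as [j Hj].
apply (finite_enum (Xn n) (N ^ j)); intros l Hl Hx.
apply (net_packing j n x0 1); auto.
- specialize (Hj j (le_n j)); rewrite Rabs_right in Hj by (apply Rle_ge, pow_le; lra).
  pose proof (pow_lt a n ltac:(lra)).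
  apply Rmult_le_reg_l with (2 * a ^ n); [lra|].
  replace (2 * a ^ n * (2 ^ j * (sc n / 2))) with (2 ^ j) by (field; lra); lra.
- intros y Hy; split; auto; pose proof (dist_le_half y x0); lra.
Qed.

(** Horizontal adjacency, with equal vertices allowed. *)
Definition nb k u v := exists z, d u z < lam * sc k /\ d v z < lam * sc k.

Lemma nb_sym k u v : nb k u v -> nb k v u.
Proof. intros (z & H & H'); exists z; auto. Qed.

Lemma nb_6 k z u v : d u z < 6 * sc k -> d v z < 6 * sc k -> nb k u v.
Proof. pose proof (sc_pos k); exists z; split; nra. Qed.

Lemma nb_dist k u v : nb (S k) u v -> d u v < 2 * sc k.
Proof.
intros (z & H & H'); rewrite (met_sym d Hd v) in H'.
pose proof (met_tri d Hd u z v); pose proof (sc_lam k); lra.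
Qed.

(** The common point [z] of the enlarged balls is close to both parents because [lam <= a]: the
    finer radius times [lam] is at most the coarser radius. *)
Lemma nb_par k u v : Xn (S k) u -> Xn (S k) v -> nb (S k) u v ->
  nb k (par u (S k)) (par v (S k)).
Proof.
intros Hu Hv (z & H & H'); pose proof (sc_lam k); pose proof (sc_pos k).
pose proof (par_near k u Hu); pose proof (par_near k v Hv).
apply (nb_6 k z);
  [pose proof (met_tri d Hd (par u (S k)) u z) | pose proof (met_tri d Hd (par v (S k)) v z)];
  lra.
Qed.

(** * The weights *)

Section Weight.
Context {sigma : X -> nat -> R} {p eta0 eps : R} {L : nat -> list X} {J : nat}.
Context (Hp : 0 < p) (Hsig0 : forall n x, Xn n x -> 0 <= sigma x n).
Context (HS2 : S2_cond Xn par sigma p eta0) (Heta1 : 0 <= eta0 < 1)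
  (Heta : INR (N ^ 4) * eta0 <= 1 / 8).
Context (HL : forall n, NoDup (L n) /\ forall x, In x (L n) <-> Xn n x).
(** [eps] and [J] may depend on [a], unlike [eta0]: [N ^ J] bounds the numbers of children and of
    horizontal neighbours of a vertex, and [eps] is small enough to absorb it. *)
Context (Heps : 0 < eps <= 1) (HJ : 4 * a <= 2 ^ J) (HepsJ : pw eps p * INR (N ^ J) <= 1 / 4).

Lemma in_L n x : In x (L n) <-> Xn n x.
Proof. apply HL. Qed.

Lemma sigma_le_1 n x : Xn (S n) x -> sigma x (S n) <= 1.
Proof.
intros Hx; apply Rnot_lt_le; intros H1.
pose proof (HS2 n _ (par_in n x Hx) (x :: nil) ltac:(repeat constructor; easy)
  ltac:(intros y [<- | []]; auto)) as H; cbn [fold_right] in H.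
pose proof (pw_lt 1 (sigma x (S n)) p Hp ltac:(lra)); rewrite pw_1 in *; lra.
Qed.

(* The candidate value at [(w, k+1)] dictated by the admissibility condition (S1):
   every vertex [u] of level [k] whose paths may pass through [w] asks for
   [sigma w * P u]. *)
Definition demand (P : X -> R) k w :=
  sigma w (S k) * lmax (L k) (fun u => ind (d u w < 4 * sc k) * P u).

(* The demand is smoothed over one horizontal step with factor [eps], and bounded
   below by [eps] times the parent; this keeps neighbours comparable with the same
   constant [/ eps] on all levels. *)
Fixpoint wt k w : R :=
  match k with
  | O => 1
  | S k' => Rmax (eps * wt k' (par w k))
      (Rmax (demand (wt k') k' w)
         (lmax (L k) (fun w' => ind (nb k w' w) * (eps * demand (wt k') k' w'))))
  end.

Lemma wt_par_ge k w : eps * wt k (par w (S k)) <= wt (S k) w.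
Proof. apply Rmax_l. Qed.

Lemma wt_pos k w : 0 < wt k w.
Proof.
revert w; induction k as [|k IH]; intros w; [simpl; lra|].
eapply Rlt_le_trans; [|apply wt_par_ge]; apply Rmult_lt_0_compat; [lra | apply IH].
Qed.

Lemma demand_le_wt k w : demand (wt k) k w <= wt (S k) w.
Proof. simpl; eapply Rle_trans; [apply Rmax_l | apply Rmax_r]. Qed.

Lemma demand_nb_le_wt k w w' : Xn (S k) w' -> nb (S k) w' w ->
  eps * demand (wt k) k w' <= wt (S k) w.
Proof.
intros Hw' Hn; cbn [wt]; eapply Rle_trans; [|apply Rmax_r].
eapply Rle_trans; [|apply Rmax_r].
eapply Rle_trans; [|apply lmax_ge, in_L, Hw'].
cbv beta; rewrite ind_true by easy; lra.
Qed.

Lemma demand_ge0 k w : Xn (S k) w -> 0 <= demand (wt k) k w.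
Proof. intros; apply Rmult_le_pos; auto; apply lmax_ge0. Qed.

Lemma demand_le k w c : Xn (S k) w -> 0 <= c ->
  (forall u, Xn k u -> d u w < 4 * sc k -> wt k u <= c) -> demand (wt k) k w <= c.
Proof.
intros Hw Hc H; unfold demand.
rewrite <- (Rmult_1_l c); apply Rmult_le_compat; auto; [apply lmax_ge0 | now apply sigma_le_1|].
apply lmax_le; auto; intros u Hu; apply in_L in Hu.
destruct (classic (d u w < 4 * sc k)); [rewrite ind_true | rewrite ind_false]; auto;
  rewrite ?Rmult_0_l, ?Rmult_1_l; auto.
Qed.

Lemma wt_sigma k u w : Xn k u -> Xn (S k) w -> d u w < 4 * sc k ->
  sigma w (S k) * wt k u <= wt (S k) w.
Proof.
intros Hu Hw Huw; eapply Rle_trans; [|apply demand_le_wt].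
apply Rmult_le_compat_l; auto.
eapply Rle_trans; [|apply lmax_ge, in_L, Hu].
cbv beta; rewrite ind_true by easy; lra.
Qed.

Lemma wt_S_le k w c : 0 <= c -> eps * wt k (par w (S k)) <= c ->
  demand (wt k) k w <= c ->
  (forall w', Xn (S k) w' -> nb (S k) w' w -> eps * demand (wt k) k w' <= c) ->
  wt (S k) w <= c.
Proof.
intros Hc H1 H2 H3; cbn [wt]; apply Rmax_lub; auto; apply Rmax_lub; auto.
apply lmax_le; auto; intros w' Hw'; apply in_L in Hw'.
destruct (classic (nb (S k) w' w)); [rewrite ind_true | rewrite ind_false]; auto;
  rewrite ?Rmult_0_l, ?Rmult_1_l; auto.
Qed.

(* [demand] at a neighbour [w'] of [w] involves only vertices adjacent to the parents
   of all the neighbours of [w]. *)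
Lemma demand_nb_le k w w' w'' :
  (forall u v, Xn k u -> Xn k v -> nb k u v -> eps * wt k u <= wt k v) ->
  Xn (S k) w' -> Xn (S k) w'' -> nb (S k) w' w -> nb (S k) w'' w ->
  eps * demand (wt k) k w' <= wt k (par w'' (S k)).
Proof.
intros IH Hw' Hw'' Hn' Hn''.
pose proof (wt_pos k (par w'' (S k))).
apply Rmult_le_reg_l with (/ eps); [apply Rinv_0_lt_compat; lra|].
rewrite <- Rmult_assoc, Rinv_l, Rmult_1_l by lra.
apply demand_le; auto.
- apply Rmult_le_pos; [apply Rlt_le, Rinv_0_lt_compat|]; lra.
- intros u Hu Huw'.
  apply Rmult_le_reg_l with eps; [lra|].
  rewrite <- Rmult_assoc, Rinv_r, Rmult_1_l by lra.
  apply IH; auto; [now apply par_in|].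
  pose proof (nb_dist _ _ _ Hn'); pose proof (nb_dist _ _ _ Hn'').
  pose proof (par_near _ _ Hw''); pose proof (sc_pos k).
  apply (nb_6 k w); [pose proof (met_tri d Hd u w' w)
    | pose proof (met_tri d Hd (par w'' (S k)) w'' w)]; lra.
Qed.

Lemma nb_refl k w : nb k w w.
Proof. pose proof (sc_pos k); apply (nb_6 k w); rewrite dist_refl; lra. Qed.

(** Each term of the maximum defining the weight of [u] is matched at [v]: the parent term by
    induction, the parents being adjacent; the demand of [u] by the smoothing term of [v]; the
    smoothing term of [u] by the parent term of [v], through [demand_nb_le]. *)
Lemma wt_nb k u v : Xn k u -> Xn k v -> nb k u v -> eps * wt k u <= wt k v.
Proof.
revert u v; induction k as [|k IH]; intros u v Hu Hv Huv; [simpl; lra|].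
pose proof (wt_pos (S k) v) as Hpos.
apply Rmult_le_reg_l with (/ eps); [apply Rinv_0_lt_compat; lra|].
rewrite <- Rmult_assoc, Rinv_l, Rmult_1_l by lra.
assert (E : forall t, eps * t <= wt (S k) v -> t <= / eps * wt (S k) v).
{ intros t Ht; apply Rmult_le_reg_l with eps; [lra|].
  now rewrite <- Rmult_assoc, Rinv_r, Rmult_1_l by lra. }
apply wt_S_le.
- apply E; lra.
- apply E; eapply Rle_trans; [|apply wt_par_ge]; apply Rmult_le_compat_l; [lra|].
  apply IH; try now apply par_in. now apply nb_par.
- apply E; now apply demand_nb_le_wt.
- intros w' Hw' Hn; apply E.
  eapply Rle_trans; [|apply wt_par_ge]; apply Rmult_le_compat_l; [lra|].
  apply demand_nb_le with u; auto; now apply nb_sym.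
Qed.

Lemma wt_par_le k w : Xn (S k) w -> eps * wt (S k) w <= wt k (par w (S k)).
Proof.
intros Hw; pose proof (wt_pos k (par w (S k))).
assert (E : forall t, eps * t <= wt k (par w (S k)) -> t <= / eps * wt k (par w (S k))).
{ intros t Ht; apply Rmult_le_reg_l with eps; [lra|].
  now rewrite <- Rmult_assoc, Rinv_r, Rmult_1_l by lra. }
apply Rmult_le_reg_l with (/ eps); [apply Rinv_0_lt_compat; lra|].
rewrite <- Rmult_assoc, Rinv_l, Rmult_1_l by lra.
apply wt_S_le.
- apply E; lra.
- apply E; assert (eps * eps <= 1) by nra; rewrite <- Rmult_assoc; nra.
- apply E, demand_nb_le with w; auto using wt_nb, nb_refl.
- intros w' Hw' Hn; apply E.
  assert (H1 : eps * demand (wt k) k w' <= wt k (par w (S k)))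
    by (apply demand_nb_le with w; auto using wt_nb, nb_refl).
  nra.
Qed.

(** * Decay of the mass *)

Definition mass k x rho := sum (L k) (fun w => ind (d w x < rho) * pw (wt k w) p).

Lemma mass_le k x rho rho' : rho <= rho' -> mass k x rho <= mass k x rho'.
Proof.
intros H; apply sum_le; intros w _; apply Rmult_le_compat_r; [apply pw_ge0|].
destruct (classic (d w x < rho)).
- rewrite !ind_true; lra.
- rewrite ind_false by easy; apply ind_bounds.
Qed.

Lemma children_count k u :
  sum (L (S k)) (fun w => ind (par w (S k) = u) * 1) <= INR (N ^ J).
Proof.
apply sum_ind_le; [apply HL|]; intros l Hl Hin.
rewrite sum_const, Rmult_1_r.
apply (net_packing_R J (S k) u (sc k)); auto.
- rewrite (sc_S k); pose proof (sc_pos (S k)); nra.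
- intros w Hw; destruct (Hin w Hw) as [Hw' <-]; apply in_L in Hw'; split; auto.
  rewrite (met_sym d Hd); now apply par_near.
Qed.

Lemma neighbours_count k u :
  sum (L (S k)) (fun w => ind (nb (S k) u w) * 1) <= INR (N ^ J).
Proof.
apply sum_ind_le; [apply HL|]; intros l Hl Hin.
rewrite sum_const, Rmult_1_r.
apply (net_packing_R J (S k) u (2 * sc k)); auto.
- rewrite (sc_S k); pose proof (sc_pos (S k)); nra.
- intros w Hw; destruct (Hin w Hw) as [Hw' Hn]; apply in_L in Hw'; split; auto.
  rewrite (met_sym d Hd); now apply nb_dist.
Qed.

Lemma children_sigma k v : Xn k v ->
  sum (L (S k)) (fun w => ind (par w (S k) = v) * pw (sigma w (S k)) p) <= eta0.
Proof.
intros Hv; apply sum_ind_le; [apply HL|]; intros l Hl Hin.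
rewrite <- sum_fold_right; apply (HS2 k v Hv l Hl).
intros x Hx; destruct (Hin x Hx); split; auto; now apply in_L.
Qed.

(** The vertices in question have parents within [5 a^-k] of [u]. There are at most [N ^ 4] such
    parents, and (S2) bounds the share of each by [eta0]; hence a threshold that does not involve
    [a]. *)
Lemma near_sigma k u : Xn k u ->
  sum (L (S k)) (fun w => ind (d u w < 4 * sc k) * pw (sigma w (S k)) p) <= 1 / 8.
Proof.
intros Hu; pose proof (sc_pos k).
eapply Rle_trans; [apply sum_fiber with (l' := L k) (h := fun w => par w (S k))|].
- intros; apply Rmult_le_pos; [apply ind_bounds | apply pw_ge0].
- intros w Hw; apply in_L, par_in, in_L; easy.
- eapply Rle_trans; [apply sum_le with (g := fun v => eta0 * (ind (d v u < 5 * sc k) * 1))|].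
  + intros v Hv; apply in_L in Hv.
    destruct (classic (d v u < 5 * sc k)) as [Hvu | Hvu].
    * rewrite (ind_true (d v u < _)), !Rmult_1_r by easy.
      eapply Rle_trans; [|apply (children_sigma k v Hv)].
      apply sum_le; intros w _; apply Rmult_le_compat_l; [apply ind_bounds|].
      pose proof (ind_bounds (d u w < 4 * sc k)); pose proof (pw_ge0 (sigma w (S k)) p); nra.
    * rewrite (ind_false (d v u < _)), Rmult_0_l, Rmult_0_r by easy.
      rewrite <- (sum_0 (L (S k))); apply sum_le; intros w Hw; apply in_L in Hw.
      destruct (classic (par w (S k) = v)) as [<- | Hne];
        [|rewrite (ind_false _ Hne); lra].
      rewrite (ind_false (d u w < 4 * sc k)); [lra|].
      intros Huw; apply Hvu.
      pose proof (par_near k w Hw); pose proof (met_tri d Hd (par w (S k)) w u).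
      rewrite (met_sym d Hd w u) in *; lra.
  + rewrite sum_scal; rewrite Rmult_comm.
    eapply Rle_trans; [|apply Heta]; apply Rmult_le_compat_r; [easy|].
    apply sum_ind_le; [apply HL|]; intros l Hl Hin.
    rewrite sum_const, Rmult_1_r.
    apply (net_packing_R 4 k u (5 * sc k)); auto; [lra|].
    intros v Hv; destruct (Hin v Hv); split; auto; now apply in_L.
Qed.

(** A majorant of the [p]-th power of [demand]: the maximum over [u] becomes a sum, so that
    summations can be exchanged. *)
Definition demand_sum k w :=
  sum (L k) (fun u => ind (d u w < 4 * sc k) * (pw (sigma w (S k)) p * pw (wt k u) p)).

Lemma demand_sum_ge0 k w : 0 <= demand_sum k w.
Proof.
apply sum_ge0; intros; apply Rmult_le_pos; [apply ind_bounds|].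
apply Rmult_le_pos; apply pw_ge0.
Qed.

Lemma pw_ind (Q : Prop) t y : pw (ind Q * t) y = ind Q * pw t y.
Proof.
destruct (classic Q); [rewrite ind_true | rewrite ind_false]; auto;
  rewrite ?Rmult_1_l, ?Rmult_0_l; auto; apply pw_nonpos; lra.
Qed.

Lemma pw_demand k w : Xn (S k) w -> pw (demand (wt k) k w) p <= demand_sum k w.
Proof.
intros Hw; unfold demand; rewrite pw_mult; auto using lmax_ge0.
eapply Rle_trans; [apply Rmult_le_compat_l; [apply pw_ge0 | apply pw_lmax; lra]|].
rewrite <- sum_scal; apply sum_le; intros u _; rewrite pw_ind; lra.
Qed.

Lemma pw_wt_S k w : Xn (S k) w ->
  pw (wt (S k) w) p <= pw eps p * pw (wt k (par w (S k))) p + demand_sum k w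
    + pw eps p * sum (L (S k)) (fun w' => ind (nb (S k) w' w) * demand_sum k w').
Proof.
intros Hw; cbn [wt].
eapply Rle_trans; [apply pw_max; lra|]; rewrite Rplus_assoc; apply Rplus_le_compat.
- rewrite pw_mult; [lra | lra | apply Rlt_le, wt_pos].
- eapply Rle_trans; [apply pw_max; lra|]; apply Rplus_le_compat; [now apply pw_demand|].
  eapply Rle_trans; [apply pw_lmax; lra|].
  rewrite <- sum_scal; apply sum_le; intros w' Hw'; apply in_L in Hw'.
  rewrite pw_ind, pw_mult; [|lra|now apply demand_ge0].
  pose proof (pw_demand k w' Hw'); pose proof (ind_bounds (nb (S k) w' w)).
  pose proof (pw_ge0 eps p).
  apply Rle_trans with (ind (nb (S k) w' w) * (pw eps p * demand_sum k w'));
    [|apply Req_le; ring].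
  apply Rmult_le_compat_l; [easy|]; now apply Rmult_le_compat_l.
Qed.

Lemma ind_imp (Q Q' : Prop) : (Q -> Q') -> ind Q <= ind Q'.
Proof.
intros H; destruct (classic Q).
- rewrite !ind_true; auto; lra.
- rewrite (ind_false Q) by easy; apply ind_bounds.
Qed.

Lemma ind_and (Q Q' : Prop) : ind (Q /\ Q') = ind Q * ind Q'.
Proof.
destruct (classic Q); [destruct (classic Q')|].
- rewrite !ind_true; auto; lra.
- rewrite (ind_false Q'), (ind_false (Q /\ Q')); tauto || lra.
- rewrite (ind_false Q), (ind_false (Q /\ Q')); tauto || lra.
Qed.

Lemma mass_par k x rho :
  sum (L (S k)) (fun w => ind (d w x < rho) * pw (wt k (par w (S k))) p)
  <= INR (N ^ J) * mass k x (rho + 6 * sc k).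
Proof.
pose proof (sc_pos k).
eapply Rle_trans; [apply sum_fiber with (l' := L k) (h := fun w => par w (S k))|].
- intros; apply Rmult_le_pos; [apply ind_bounds | apply pw_ge0].
- intros w Hw; apply in_L, par_in, in_L; easy.
- unfold mass; rewrite <- sum_scal; apply sum_le; intros u _.
  set (c := ind (d u x < _) * _).
  assert (0 <= c) by (apply Rmult_le_pos; [apply ind_bounds | apply pw_ge0]).
  eapply Rle_trans; [|apply Rmult_le_compat_r; [easy | apply (children_count k u)]].
  rewrite (Rmult_comm _ c), <- sum_scal; apply sum_le; intros w Hw; apply in_L in Hw.
  destruct (classic (par w (S k) = u)) as [<- | Hne];
    [|rewrite (ind_false _ Hne); lra].
  rewrite (ind_true (par w (S k) = _)), Rmult_1_l, !Rmult_1_r by easy.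
  apply Rmult_le_compat_r; [apply pw_ge0|]; apply ind_imp; intros Hwx.
  pose proof (par_near k w Hw); pose proof (met_tri d Hd (par w (S k)) w x); lra.
Qed.

Lemma mass_demand k x rho :
  sum (L (S k)) (fun w => ind (d w x < rho + 2 * sc k) * demand_sum k w)
  <= 1 / 8 * mass k x (rho + 6 * sc k).
Proof.
unfold demand_sum.
rewrite (sum_ext _ _ (fun w => sum (L k) (fun u => ind (d w x < rho + 2 * sc k) *
  (ind (d u w < 4 * sc k) * (pw (sigma w (S k)) p * pw (wt k u) p)))))
  by (intros; now rewrite sum_scal).
rewrite sum_swap; unfold mass; rewrite <- sum_scal; apply sum_le; intros u Hu.
apply in_L in Hu.
set (c := ind (d u x < _) * _).
assert (0 <= c) by (apply Rmult_le_pos; [apply ind_bounds | apply pw_ge0]).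
eapply Rle_trans; [|apply Rmult_le_compat_r; [easy | apply (near_sigma k u Hu)]].
rewrite (Rmult_comm _ c), <- sum_scal; apply sum_le; intros w Hw.
rewrite <- Rmult_assoc, <- ind_and; unfold c.
assert (Hi : ind (d w x < rho + 2 * sc k /\ d u w < 4 * sc k)
  <= ind (d u x < rho + 6 * sc k) * ind (d u w < 4 * sc k)).
{ rewrite <- ind_and; apply ind_imp; intros [H1 H2]; split; auto.
  pose proof (met_tri d Hd u w x); lra. }
pose proof (pw_ge0 (sigma w (S k)) p); pose proof (pw_ge0 (wt k u) p).
assert (0 <= pw (sigma w (S k)) p * pw (wt k u) p) by now apply Rmult_le_pos.
eapply Rle_trans; [apply Rmult_le_compat_r; [easy | apply Hi]|].
apply Req_le; ring.
Qed.

(** Parents contribute at most 1/4 of the coarser mass, demands 1/8, and smoothed demands 1/4 of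
    1/8. *)
Lemma mass_S k x rho : mass (S k) x rho <= / 2 * mass k x (rho + 6 * sc k).
Proof.
pose proof (sc_pos k).
pose proof (mass_par k x rho) as H1; pose proof (mass_demand k x rho) as H2.
pose proof (pw_ge0 eps p) as He0.
assert (Hm : 0 <= mass k x (rho + 6 * sc k))
  by (apply sum_ge0; intros; apply Rmult_le_pos; [apply ind_bounds | apply pw_ge0]).
set (D := sum (L (S k)) (fun w => ind (d w x < rho + 2 * sc k) * demand_sum k w)) in *.
set (Mp := sum (L (S k)) _) in H1.
assert (H3 : sum (L (S k)) (fun w => ind (d w x < rho) * demand_sum k w) <= D).
{ apply sum_le; intros w _; apply Rmult_le_compat_r; [apply demand_sum_ge0|].
  apply ind_imp; lra. }
assert (H4 : sum (L (S k)) (fun w => ind (d w x < rho) *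
    sum (L (S k)) (fun w' => ind (nb (S k) w' w) * demand_sum k w')) <= INR (N ^ J) * D).
{ rewrite (sum_ext _ _ (fun w => sum (L (S k)) (fun w' => ind (d w x < rho) *
    (ind (nb (S k) w' w) * demand_sum k w')))) by (intros; now rewrite sum_scal).
  rewrite sum_swap; unfold D; rewrite <- sum_scal; apply sum_le; intros w' Hw'.
  set (c := ind (d w' x < _) * _).
  assert (0 <= c) by (apply Rmult_le_pos; [apply ind_bounds | apply demand_sum_ge0]).
  eapply Rle_trans; [|apply Rmult_le_compat_r; [easy | apply (neighbours_count k w')]].
  rewrite (Rmult_comm _ c), <- sum_scal; apply sum_le; intros w Hw.
  rewrite <- Rmult_assoc, <- ind_and; unfold c.
  assert (Hi : ind (d w x < rho /\ nb (S k) w' w)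
    <= ind (d w' x < rho + 2 * sc k) * ind (nb (S k) w' w)).
  { rewrite <- ind_and; apply ind_imp; intros [G1 G2]; split; auto.
    pose proof (nb_dist _ _ _ G2); pose proof (met_tri d Hd w' w x); lra. }
  eapply Rle_trans; [apply Rmult_le_compat_r; [apply demand_sum_ge0 | apply Hi]|].
  apply Req_le; ring. }
assert (H5 : mass (S k) x rho <= pw eps p * Mp + D + pw eps p * (INR (N ^ J) * D)).
{ eapply Rle_trans; [apply sum_le; intros w Hw; apply in_L in Hw;
    apply Rmult_le_compat_l; [apply ind_bounds | apply (pw_wt_S k w Hw)]|].
  rewrite (sum_ext _ _ (fun w => pw eps p * (ind (d w x < rho) * pw (wt k (par w (S k))) p)
    + ind (d w x < rho) * demand_sum k w + pw eps p * (ind (d w x < rho) *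
      sum (L (S k)) (fun w' => ind (nb (S k) w' w) * demand_sum k w')))) by (intros; ring).
  rewrite !sum_plus, !sum_scal.
  apply Rplus_le_compat; [apply Rplus_le_compat|]; [apply Req_le; reflexivity | easy|].
  now apply Rmult_le_compat_l. }
assert (0 <= D)
  by (apply sum_ge0; intros; apply Rmult_le_pos; [apply ind_bounds | apply demand_sum_ge0]).
assert (pw eps p * Mp <= 1 / 4 * mass k x (rho + 6 * sc k)) by nra.
nra.
Qed.

(** The radius grows by [6 a^-i] at each level [i >= n]; as [a >= 6], the total is at most
    [36/5 a^-n]. *)
Lemma mass_decay j n x rho :
  mass (n + j) x rho <= (/ 2) ^ j * mass n x (rho + 36 / 5 * sc n).
Proof.
revert n; induction j as [|j IH]; intros n.
- rewrite Nat.add_0_r; simpl; rewrite Rmult_1_l; apply mass_le; pose proof (sc_pos n); lra.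
- replace (n + S j)%nat with (S n + j)%nat by lia.
  eapply Rle_trans; [apply IH|].
  rewrite <- (tech_pow_Rmult (/ 2) j), (Rmult_comm (/ 2)), Rmult_assoc.
  apply Rmult_le_compat_l; [apply pow_le; lra|].
  eapply Rle_trans; [apply (mass_S n x _)|].
  apply Rmult_le_compat_l; [lra|]; apply mass_le; pose proof (sc_6 n); lra.
Qed.

(** One level up, both parents lie within six radii of [x], hence are adjacent; the three factors
    [eps] pay for going up, across and down. At level 0 all weights are 1. *)
Lemma wt_near_30 n x v w : Xn n v -> Xn n w -> d v x < 2 * sc n -> d w x < 30 * sc n ->
  eps ^ 3 * wt n w <= wt n v.
Proof.
intros Hv Hw Hvx Hwx.
destruct n as [|n].
- pose proof (pow_incr eps 1 3 ltac:(lra)); rewrite pow1 in *; simpl wt; lra.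
- pose proof (wt_par_le n w Hw); pose proof (wt_par_ge n v).
  pose proof (par_in _ _ Hv); pose proof (par_in _ _ Hw).
  assert (eps * wt n (par w (S n)) <= wt n (par v (S n))).
  { apply wt_nb; auto.
    pose proof (sc_6 n); pose proof (sc_pos (S n)).
    pose proof (par_near n v Hv); pose proof (par_near n w Hw).
    pose proof (met_tri d Hd (par v (S n)) v x); pose proof (met_tri d Hd (par w (S n)) w x).
    apply (nb_6 n x); lra. }
  replace (eps ^ 3 * wt (S n) w) with (eps * (eps * (eps * wt (S n) w))) by ring.
  apply Rle_trans with (eps * (eps * wt n (par w (S n)))); [|nra].
  do 2 (apply Rmult_le_compat_l; [lra|]); easy.
Qed.

(** [N ^ 6] bounds the number of vertices within [30 a^-n] of a point, and [/ eps ^ 3] is the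
    comparison constant of [wt_near_30]. *)
Definition decay_const := INR (N ^ 6) * pw (/ eps ^ 3) p.

Lemma mass_le_wt n x v : Xn n v -> d v x < 2 * sc n ->
  mass n x (30 * sc n) <= decay_const * pw (wt n v) p.
Proof.
intros Hv Hvx; pose proof (sc_pos n).
assert (He : 0 < eps ^ 3) by (apply pow_lt; lra).
apply sum_ind_le; [apply HL|]; intros l Hl Hin.
apply Rle_trans with (sum l (fun _ => pw (/ eps ^ 3) p * pw (wt n v) p)).
- apply sum_le; intros w Hw; destruct (Hin w Hw) as [Hw' Hwx]; apply in_L in Hw'.
  pose proof (wt_pos n v); pose proof (Rinv_0_lt_compat _ He).
  rewrite <- pw_mult by lra; apply pw_le; [lra|].
  apply Rmult_le_reg_l with (eps ^ 3); auto.
  rewrite <- Rmult_assoc, Rinv_r, Rmult_1_l by lra.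
  now apply wt_near_30 with x.
- rewrite sum_const; unfold decay_const; rewrite Rmult_assoc.
  apply Rmult_le_compat_r; [apply Rmult_le_pos; apply pw_ge0|].
  apply (net_packing_R 6 n x (30 * sc n)); auto; [lra|].
  intros w Hw; destruct (Hin w Hw); split; auto; now apply in_L.
Qed.

Lemma mass_decay_wt n j x v : Xn n v -> d v x < 2 * sc n ->
  mass (n + j) x (20 * sc n) <= (/ 2) ^ j * (decay_const * pw (wt n v) p).
Proof.
intros Hv Hvx; pose proof (sc_pos n).
eapply Rle_trans; [apply mass_decay|].
apply Rmult_le_compat_l; [apply pow_le; lra|].
eapply Rle_trans; [apply mass_le | apply (mass_le_wt n x v Hv Hvx)]; lra.
Qed.

(** A single term is at most the whole mass; taking [p]-th roots in [mass_decay_wt] gives the rate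
    [2^(-1/p)] per level. *)
Lemma wt_decay n j x v w : Xn n v -> d v x < 2 * sc n ->
  Xn (n + j) w -> d w x < 20 * sc n ->
  wt (n + j) w <= pw decay_const (/ p) * pw (/ 2) (/ p) ^ j * wt n v.
Proof.
intros Hv Hvx Hw Hwx.
pose proof (wt_pos n v); pose proof (wt_pos (n + j) w).
assert (Hip : 0 < / p) by now apply Rinv_0_lt_compat.
assert (Hpw : forall t, 0 <= t -> pw (pw t p) (/ p) = t)
  by (intros t Ht; rewrite pw_pw, Rinv_r, pw_id; lra).
assert (Hc : 0 <= decay_const) by (apply Rmult_le_pos; [apply pos_INR | apply pw_ge0]).
assert (0 <= (/ 2) ^ j) by (apply pow_le; lra).
rewrite <- (Hpw (wt (n + j) w)) by lra; rewrite <- (Hpw (wt n v)) by lra.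
rewrite <- pw_pow_l by lra.
assert (0 <= pw (wt n v) p) by apply pw_ge0.
assert (0 <= decay_const * (/ 2) ^ j) by now apply Rmult_le_pos.
rewrite <- !pw_mult by easy.
apply pw_le; [lra|].
eapply Rle_trans; [|eapply Rle_trans; [apply (mass_decay_wt n j x v Hv Hvx) | apply Req_le; ring]].
unfold mass; rewrite <- (Rmult_1_l (pw _ _)), <- (ind_true (d w x < 20 * sc n)) by easy.
apply (sum_term (L (n + j)) (fun w => ind (d w x < 20 * sc n) * pw (wt (n + j) w) p)).
- intros; apply Rmult_le_pos; [apply ind_bounds | apply pw_ge0].
- now apply in_L.
Qed.

(** Climb from [w] through [j] parents to level [n], then cross to [v] by one horizontal step:
    [j + 1] factors [eps]. *)
Lemma wt_growth n j x v w : Xn n v -> d v x < 2 * sc n ->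
  Xn (n + j) w -> d w x < 2 * sc (n + j) -> eps ^ S j * wt n v <= wt (n + j) w.
Proof.
intros Hv Hvx; revert w; induction j as [|j IH]; intros w Hw Hwx.
- rewrite Nat.add_0_r in *; simpl; rewrite Rmult_1_r; apply wt_nb; auto.
  pose proof (sc_pos n); apply (nb_6 n x); lra.
- rewrite Nat.add_succ_r in *.
  eapply Rle_trans; [|apply wt_par_ge].
  rewrite <- (tech_pow_Rmult eps (S j)), Rmult_assoc; apply Rmult_le_compat_l; [lra|].
  apply IH; [now apply par_in|].
  pose proof (par_near _ _ Hw); pose proof (met_tri d Hd (par w (S (n + j))) w x).
  pose proof (sc_6 (n + j)); pose proof (sc_pos (n + j)); lra.
Qed.

(** * Chains of balls *)

(** Steps are limited to half the radius so that, after a displacement of at most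
    [24/5 a^-m <= 4/5 a^-l] with [m > l], they are still short enough to become [sc_fine] steps. *)
Inductive cover_chain : X -> X -> R -> Prop :=
| cc_nil x : cover_chain x x 0
| cc_cons y x z l v c : Xn l v -> d v y < 2 * sc l -> d v x < 2 * sc l ->
    d y x <= / 2 * sc l -> cover_chain x z c -> cover_chain y z (wt l v + c).

(* The chains met when a chain of [cover_chain] is rewritten by chains using vertices of
   level at most [m] only: [sc_fine] steps use a vertex of level [m] produced by the
   rewriting, [sc_coarse] steps are original ones, with their first end point displaced
   by at most [24/5 a^-m], i.e. the sum of [4 a^-i] over [i >= m]. *)
Inductive stage_chain (m : nat) : X -> X -> R -> Prop :=
| sc_nil x : stage_chain m x x 0
| sc_coarse y x z l v c : (l < m)%nat -> Xn l v -> d v x < 2 * sc l ->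
    d y x <= / 2 * sc l + 24 / 5 * sc m -> stage_chain m x z c ->
    stage_chain m y z (wt l v + c)
| sc_fine y x z v c : Xn m v -> d v y <= 2 * sc m -> d v x <= 4 * sc m ->
    stage_chain m x z c -> stage_chain m y z (eps * wt m v + c).

(** Once [m] exceeds all levels of the finite chain, every step is [sc_coarse]. *)
Lemma cover_chain_stage y z c : cover_chain y z c ->
  exists m0, forall m, (m0 <= m)%nat -> stage_chain m y z c.
Proof.
induction 1 as [x | y x z l v c Hv Hvy Hvx Hyx _ [m0 IH]].
- exists 0%nat; intros; constructor.
- exists (Nat.max m0 (S l)); intros m Hm.
  apply sc_coarse with x; auto; try lia; [|apply IH; lia].
  pose proof (sc_pos m); lra.
Qed.

Section Admissible.
Context (HS1 : S1_cond d a lam Xn sigma).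

Lemma last_cons_default (y : X) l x : last (y :: l) x = last l y.
Proof.
revert x y; induction l as [|z l IH]; intros x y; auto.
rewrite (IH y z), <- (IH x z); easy.
Qed.

Lemma chain_rcons (P : X -> X -> Prop) x l y :
  chain P x l -> P (last l x) y -> chain P x (l ++ y :: nil).
Proof.
revert x; induction l as [|z l IH]; intros x; simpl; [tauto|].
intros [Hz Hc] Hl; split; auto; apply IH; auto.
now rewrite <- (last_cons_default z l x).
Qed.

(** The path up to [v] lies in [Gamma_n(u)]. Its vertices are within [4 a^-n] of [u], so each weighs
    at least [sigma] times the weight of [u], and (S1) sums these bounds. *)
Lemma exit_cost n u v0 g v : Xn n u -> Forall (Xn (S n)) (v0 :: g) -> Xn (S n) v ->
  chain (hedge d a lam (S n)) v0 g -> hedge d a lam (S n) (last g v0) v ->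
  d u v0 < sc n -> Forall (fun w => d u w < 2 * sc n) (v0 :: g) ->
  2 * sc n <= d u v < 4 * sc n ->
  wt n u <= sum (v0 :: g) (wt (S n)) + wt (S n) v.
Proof.
intros Hu Hg Hv Hch Hlast Hv0 Hin [Hout Hv4].
assert (HG : in_Gamma d a lam Xn n u (v0 :: g ++ v :: nil)).
{ exists v0, (g ++ v :: nil); split; [easy|]; split; [|split; [|split]].
  - rewrite app_comm_cons; apply Forall_app; auto.
  - now apply chain_rcons.
  - easy.
  - rewrite last_last; unfold ball, Rdiv; lra. }
pose proof (HS1 n u _ Hu HG) as H1; rewrite (sum_fold_right _ (fun x => sigma x (S n))) in H1.
pose proof (wt_pos n u).
replace (sum (v0 :: g) (wt (S n)) + wt (S n) v) with (sum (v0 :: g ++ v :: nil) (wt (S n)))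
  by (simpl; rewrite sum_app; simpl; ring).
apply Rle_trans with (sum (v0 :: g ++ v :: nil) (fun w => wt n u * sigma w (S n))).
- rewrite sum_scal; nra.
- pose proof (sc_pos n); apply sum_le; intros w Hw; rewrite Rmult_comm.
  rewrite app_comm_cons in Hw; apply in_app_iff in Hw as [Hw | [<- | []]].
  + rewrite Forall_forall in *; specialize (Hin w Hw).
    apply wt_sigma; auto; lra.
  + apply wt_sigma; auto; lra.
Qed.

(* Second half of the statement: the chain is read while a horizontal path [v0 :: g] of
   level [n+1] staying in the ball of [u] is in progress since the point [y0].  Leaving
   the ball pays for [u] by (S1); a path which does not leave it is absorbed into the
   next coarse step. *)
Lemma stage_chain_coarsen n y z c : stage_chain (S n) y z c ->
  (exists z' c', stage_chain n y z' c' /\ c' <= c /\ d z' z <= 4 * sc n) /\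
  forall u y0 v0 g, Xn n u -> d u y0 <= 4 / 3 * sc n -> Forall (Xn (S n)) (v0 :: g) ->
    chain (hedge d a lam (S n)) v0 g -> d u v0 < sc n ->
    Forall (fun w => d u w < 2 * sc n) (v0 :: g) -> d (last g v0) y <= 4 * sc (S n) ->
    exists z' c', stage_chain n y0 z' c' /\
      c' <= c + eps * sum (v0 :: g) (wt (S n)) /\ d z' z <= 4 * sc n.
Proof.
pose proof (sc_6 n) as H6; pose proof (sc_pos (S n)) as Hpos.
assert (Hlastin : forall v0 g (Q : X -> Prop), Forall Q (v0 :: g) -> Q (last g v0)).
{ intros v0 g Q H; rewrite Forall_forall in H; apply H.
  destruct g as [|w g]; [now left|].
  right; rewrite (app_removelast_last v0 (l := w :: g)) at 2 by easy.
  apply in_app_iff; right; now left. }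
assert (Hsum : forall v0 g, 0 <= eps * sum (v0 :: g) (wt (S n))).
{ intros; apply Rmult_le_pos; [lra|]; apply sum_ge0; intros; apply Rlt_le, wt_pos. }
induction 1 as [y | y x z l v c Hl Hv Hvx Hyx _ [IHA IHB] | y x z v c Hv Hvy Hvx _ [IHA IHB]].
- split.
  + exists y, 0; rewrite dist_refl; split; [constructor | lra].
  + intros u y0 v0 g Hu Huy0 _ _ _ Hin Hlast.
    specialize (Hlastin _ _ _ Hin); cbv beta in Hlastin.
    specialize (Hsum v0 g).
    exists y0, 0; split; [constructor|]; split; [lra|].
    pose proof (met_tri d Hd y0 u y); rewrite (met_sym d Hd y0 u) in *.
    pose proof (met_tri d Hd u (last g v0) y); lra.
- destruct IHA as (z' & c' & Hc & Hcc & Hz).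
  assert (Hcase : (l < n)%nat \/ l = n) by lia.
  split.
  + exists z'; destruct Hcase as [Hln | ->].
    * exists (wt l v + c'); split; [|lra]; apply sc_coarse with x; auto; lra.
    (* A coarse step of level exactly [n] becomes fine: its vertex is replaced by an adjacent one
       near [y], and the factor [eps] of fine steps absorbs the comparison. *)
    * destruct (net_cover n y) as (u & Hu & Huy).
      exists (eps * wt n u + c'); split.
      -- apply sc_fine with x; auto; [lra|]; pose proof (met_tri d Hd u y x); lra.
      -- split; [|easy]; enough (eps * wt n u <= wt n v) by lra.
         apply wt_nb; auto; apply (nb_6 n x); [pose proof (met_tri d Hd u y x)|]; lra.
  + intros u y0 v0 g Hu Huy0 _ _ _ Hin Hlast.
    specialize (Hlastin _ _ _ Hin); cbv beta in Hlastin.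
    specialize (Hsum v0 g).
    pose proof (met_tri d Hd u (last g v0) y).
    exists z'; destruct Hcase as [Hln | ->].
    (* The unfinished path is dropped: [y0] is within [4/3 + 2 + 4/6 = 4] times [a^-n] of [y], which
       the allowance of a coarse step at stage [n] accommodates. *)
    * exists (wt l v + c'); split; [|lra]; apply sc_coarse with x; auto.
      pose proof (met_tri d Hd y0 u y); rewrite (met_sym d Hd y0 u) in *.
      pose proof (met_tri d Hd y0 y x); lra.
    * pose proof (met_tri d Hd u y x).
      exists (eps * wt n u + c'); split.
      -- apply sc_fine with x; auto; lra.
      -- split; [|easy]; enough (eps * wt n u <= wt n v) by lra.
         apply wt_nb; auto; apply (nb_6 n x); lra.
- destruct IHA as (z' & c' & Hc & Hcc & Hz).
  assert (Hwv : 0 < eps * wt (S n) v)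
    by (apply Rmult_lt_0_compat; [lra | apply wt_pos]).
  split.
  (* A new horizontal path starts at [v], in the ball of its parent; [1 + 2/6 = 4/3] is the distance
     allowed between [u] and [y0]. *)
  + pose proof (par_near n v Hv) as Hnear.
    destruct (IHB (par v (S n)) y v nil) as (z1 & c1 & Hc1 & Hcc1 & Hz1);
      auto using par_in; simpl; auto.
    * pose proof (met_tri d Hd (par v (S n)) v y); lra.
    * constructor; auto; lra.
    * exists z1, c1; split; [easy|]; simpl in Hcc1; lra.
  + intros u y0 v0 g Hu Huy0 Hg Hch Hv0 Hin Hlast.
    specialize (Hsum v0 g).
    (* Horizontal edges join distinct vertices, so a repeated vertex is not appended and its cost is
       discarded. *)
    destruct (classic (last g v0 = v)) as [E | Hne].
    { destruct (IHB u y0 v0 g) as (z1 & c1 & Hc1 & Hcc1 & Hz1); auto.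
      - now rewrite E.
      - exists z1, c1; split; [easy|]; lra. }
    assert (Hedge : hedge d a lam (S n) (last g v0) v).
    { split; auto; exists y; unfold ball, Rdiv; split; nra. }
    pose proof (Hlastin _ _ _ Hin) as Hl2; cbv beta in Hl2.
    destruct (Rlt_le_dec (d u v) (2 * sc n)) as [Hv2 | Hv2].
    * destruct (IHB u y0 v0 (g ++ v :: nil)) as (z1 & c1 & Hc1 & Hcc1 & Hz1); auto.
      -- rewrite app_comm_cons; apply Forall_app; auto.
      -- now apply chain_rcons.
      -- rewrite app_comm_cons; apply Forall_app; auto.
      -- now rewrite last_last.
      -- exists z1, c1; split; [easy|]; split; [|easy].
         simpl in Hcc1 |- *; rewrite sum_app in Hcc1; simpl in Hcc1; lra.
    (* The path exits at [v], less than [(2 + 4/6 + 2/6) a^-n] from [u]: [exit_cost] pays for one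
       fine step at [u] from [y0] to [x], and the first half of the induction hypothesis handles the
       rest. *)
    * pose proof (met_tri d Hd u (last g v0) v); pose proof (met_tri d Hd (last g v0) y v).
      rewrite (met_sym d Hd y v) in *.
      pose proof (exit_cost n u v0 g v Hu Hg Hv Hch Hedge Hv0 Hin ltac:(lra)).
      pose proof (met_tri d Hd u v x).
      exists z', (eps * wt n u + c'); split; [|split; auto].
      -- apply sc_fine with x; auto; lra.
      -- assert (eps * wt n u <= eps * (sum (v0 :: g) (wt (S n)) + wt (S n) v))
           by (apply Rmult_le_compat_l; lra).
         lra.
Qed.

Lemma stage_chain_coarsen_iter k j y z c : stage_chain (k + j) y z c ->
  exists z' c', stage_chain k y z' c' /\ c' <= c /\
    d z' z <= 24 / 5 * (sc k - sc (k + j)).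
Proof.
revert z c; induction j as [|j IH]; intros z c Hc.
- rewrite Nat.add_0_r in *; exists z, c; split; auto; rewrite dist_refl; lra.
- rewrite Nat.add_succ_r in *.
  destruct (stage_chain_coarsen _ _ _ _ Hc) as [(z1 & c1 & Hc1 & Hcc1 & Hz1) _].
  destruct (IH z1 c1 Hc1) as (z2 & c2 & Hc2 & Hcc2 & Hz2).
  exists z2, c2; split; [easy|]; split; [lra|].
  (* One stage moves the end by [4 a^-(k+j)], at most [24/5 (a^-(k+j) - a^-(k+j+1))], so the bounds
     telescope. *)
  pose proof (sc_6 (k + j)); pose proof (met_tri d Hd z2 z1 z); lra.
Qed.

(** * Lower bounds for the cost of a chain *)

Local Notation rate := (pw (/ 2) (/ p)).

Lemma rate_bounds : 0 < rate < 1.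
Proof.
assert (0 < / p) by now apply Rinv_0_lt_compat.
split; [apply pw_gt0; lra|].
rewrite <- (pw_1 (/ p)); apply pw_lt; lra.
Qed.

Local Notation D := (pw decay_const (/ p)).

Lemma decay_const_ge0 : 0 <= decay_const.
Proof. apply Rmult_le_pos; [apply pos_INR | apply pw_ge0]. Qed.

Lemma wt_decay_le n j x v w : Xn n v -> d v x < 2 * sc n ->
  Xn (n + j) w -> d w x < 20 * sc n -> wt (n + j) w <= D * wt n v.
Proof.
intros Hv Hvx Hw Hwx.
eapply Rle_trans; [now apply (wt_decay n j x v w)|].
apply Rmult_le_compat_r; [apply Rlt_le, wt_pos|].
rewrite <- (Rmult_1_r D) at 2; apply Rmult_le_compat_l; [apply pw_ge0|].
pose proof rate_bounds; pose proof (pow_incr rate 1 j ltac:(lra)) as H1; now rewrite pow1 in H1.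
Qed.

Lemma stage_chain_ge0 m y z c : stage_chain m y z c -> 0 <= c.
Proof.
induction 1; [lra | |].
- pose proof (wt_pos l v); lra.
- pose proof (wt_pos m v); nra.
Qed.

(** Only the first step of the chain is used: its vertex lies near [x] and has level at most [k], so
    decay, or adjacency at level [k], bounds the weight of [v] by it. *)
Lemma stage_chain_lower k x y c v : stage_chain k x y c -> x <> y ->
  Xn k v -> d v x < 2 * sc k -> eps ^ 2 * wt k v <= (1 + D) * c.
Proof.
intros Hc Hxy Hv Hvx.
pose proof (sc_pos k); pose proof (pw_ge0 decay_const (/ p)) as HD.
pose proof (wt_pos k v) as Hwv.
destruct Hc as [y | y x' z l v0 c Hl Hv0 Hv0x Hyx Hc | y x' z v0 c Hv0 Hv0y Hv0x Hc];
  [easy | | ]; apply stage_chain_ge0 in Hc.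
- destruct (net_cover l y) as (u & Hu & Huy).
  pose proof (sc_pos l); pose proof (sc_6 l); pose proof (sc_decr (S l) k ltac:(lia)).
  assert (Huv : eps * wt l u <= wt l v0).
  { apply wt_nb; auto; apply (nb_6 l x'); [pose proof (met_tri d Hd u y x')|]; lra. }
  replace k with (l + (k - l))%nat in * by lia.
  assert (Hvu : wt (l + (k - l)) v <= D * wt l u)
    by (apply wt_decay_le with y; auto; lra).
  pose proof (wt_pos l u); pose proof (wt_pos l v0).
  apply Rle_trans with (eps * (D * wt l u)).
  + simpl; rewrite Rmult_1_r, Rmult_assoc; apply Rmult_le_compat_l; [lra|]; nra.
  + apply Rle_trans with (D * wt l v0); nra.
- assert (eps * wt k v <= wt k v0)
    by (apply wt_nb; auto; apply (nb_6 k y); lra).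
  simpl; rewrite Rmult_1_r, Rmult_assoc.
  assert (eps * (eps * wt k v) <= eps * wt k v0) by (apply Rmult_le_compat_l; lra).
  assert (0 <= eps * wt k v0) by (apply Rmult_le_pos; [lra | apply Rlt_le, wt_pos]).
  assert (0 <= D * (eps * wt k v0 + c)) by (apply Rmult_le_pos; lra); lra.
Qed.

Lemma cover_chain_lower k x y c v : cover_chain x y c -> 5 * sc k < d x y ->
  Xn k v -> d v x < 2 * sc k -> eps ^ 2 * wt k v <= (1 + D) * c.
Proof.
intros Hc Hxy Hv Hvx.
destruct (cover_chain_stage x y c Hc) as [m0 Hm].
destruct (stage_chain_coarsen_iter k m0 x y c) as (z & c' & Hc' & Hcc & Hz);
  [apply Hm; lia|].
pose proof (sc_pos k); pose proof (sc_pos (k + m0)).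
(* Since [24/5 < 5], the end point has moved by less than [d x y], so the coarsened chain is not
   trivial. *)
assert (x <> z) by (intros <-; lra).
pose proof (stage_chain_lower k x z c' v Hc' H1 Hv Hvx).
pose proof (pw_ge0 decay_const (/ p)); nra.
Qed.

(** * Concatenation and reversal of chains, infimum of their costs *)

Lemma cover_chain_app x y z c c' : cover_chain x y c -> cover_chain y z c' ->
  cover_chain x z (c + c').
Proof.
induction 1 as [x | x x' y l v c Hv H1 H2 H3 _ IH]; intros H; [now rewrite Rplus_0_l|].
rewrite Rplus_assoc; apply cc_cons with x'; auto.
Qed.

Lemma cover_chain_1 l v x y : Xn l v -> d v x < 2 * sc l -> d v y < 2 * sc l ->
  d x y <= / 2 * sc l -> cover_chain x y (wt l v).
Proof.
intros; rewrite <- (Rplus_0_r (wt l v)); apply cc_cons with y; auto; constructor.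
Qed.

Lemma cover_chain_sym x y c : cover_chain x y c -> cover_chain y x c.
Proof.
induction 1 as [x | x x' y l v c Hv H1 H2 H3 _ IH]; [constructor|].
rewrite Rplus_comm; apply cover_chain_app with x'; auto.
apply cover_chain_1; auto; now rewrite (met_sym d Hd).
Qed.

Lemma cover_chain_ge0 x y c : cover_chain x y c -> 0 <= c.
Proof. induction 1; [lra|]; pose proof (wt_pos l v); lra. Qed.

Lemma cover_chain_ex x y : exists c, cover_chain x y c.
Proof.
destruct (net_cover 0 x) as (v & Hv & _).
pose proof (dist_le_half v x); pose proof (dist_le_half v y); pose proof (dist_le_half x y).
(* Balls of level 0 have radius 1 and the diameter is 1/2, so a single step joins any two points. *)
exists (wt 0 v); apply cover_chain_1; auto; simpl; lra.
Qed.

(** The infimum is the least upper bound of the set of lower bounds, which contains 0 and is bounded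
    by the cost of any chain. *)
Lemma cover_chain_inf : exists th : X -> X -> R, forall x y,
  (forall c, cover_chain x y c -> th x y <= c) /\
  forall m, (forall c, cover_chain x y c -> m <= c) -> m <= th x y.
Proof.
assert (H : forall q : X * X, exists t, (forall c, cover_chain (fst q) (snd q) c -> t <= c) /\
  forall m, (forall c, cover_chain (fst q) (snd q) c -> m <= c) -> m <= t).
{ intros [x y]; simpl.
  destruct (completeness (fun t => forall c, cover_chain x y c -> t <= c)) as [t [H1 H2]].
  - destruct (cover_chain_ex x y) as [c Hc]; exists c; intros t Ht; auto.
  - exists 0; intros c Hc; now apply cover_chain_ge0 in Hc.
  - exists t; split; [intros c Hc; apply H2; intros s Hs; auto | exact H1]. }
apply choice in H as [f Hf]; exists (fun x y => f (x, y)); intros x y; apply (Hf (x, y)).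
Qed.

Lemma sc_lt_ex t : 0 < t -> exists k, sc k < t.
Proof.
intros Ht.
destruct (pow_lt_1_zero (/ a)) with (y := t) as [k Hk]; auto.
- rewrite Rabs_right by (apply Rle_ge, Rlt_le, Rinv_0_lt_compat; lra).
  rewrite <- Rinv_1; apply Rinv_lt_contravar; lra.
- exists k; specialize (Hk k (le_n k)); rewrite pow_inv in Hk.
  rewrite Rabs_right in Hk; auto; apply Rle_ge, Rlt_le, sc_pos.
Qed.

Lemma nat_first (P : nat -> Prop) n : P n -> P O \/ exists k, (k < n)%nat /\ ~ P k /\ P (S k).
Proof.
induction n as [|n IH]; intros Hn; auto.
destruct (classic (P n)) as [H | H]; [|right; exists n; auto].
destruct (IH H) as [|(k & Hk & H')]; auto; right; exists k; split; [lia | easy].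
Qed.

Lemma level_ex t : 0 < t <= 1 / 2 -> exists k, / 2 * sc (S k) < t <= / 2 * sc k.
Proof.
intros Ht; destruct (sc_lt_ex t) as [n Hn]; [easy|]; pose proof (sc_pos n).
destruct (nat_first (fun k => / 2 * sc k < t) n) as [H0 | (k & _ & H1 & H2)].
- lra.
- simpl in H0; lra.
- exists k; split; lra.
Qed.

(** * The metric *)

Section Theta.
Context {th : X -> X -> R}.
Context (Hth : forall x y, (forall c, cover_chain x y c -> th x y <= c) /\
  forall m, (forall c, cover_chain x y c -> m <= c) -> m <= th x y).

Lemma th_le k v x y : Xn k v -> d v x < 2 * sc k -> d v y < 2 * sc k ->
  d x y <= / 2 * sc k -> th x y <= wt k v.
Proof. intros; apply Hth; now apply cover_chain_1. Qed.

Lemma th_ge k v x y : 5 * sc k < d x y -> Xn k v -> d v x < 2 * sc k ->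
  eps ^ 2 * wt k v <= (1 + D) * th x y.
Proof.
intros Hxy Hv Hvx; pose proof (pw_ge0 decay_const (/ p)) as HD.
apply Rmult_le_reg_l with (/ (1 + D)); [apply Rinv_0_lt_compat; lra|].
rewrite <- (Rmult_assoc (/ (1 + D)) (1 + D)), Rinv_l, Rmult_1_l by lra.
apply Hth; intros c Hc.
apply Rmult_le_reg_l with (1 + D); [lra|].
rewrite <- Rmult_assoc, Rinv_r, Rmult_1_l by lra.
now apply cover_chain_lower with x y.
Qed.

Lemma th_ge0 x y : 0 <= th x y.
Proof. apply Hth; apply cover_chain_ge0. Qed.

Lemma th_refl x : th x x = 0.
Proof. apply Rle_antisym; [apply Hth; constructor | apply th_ge0]. Qed.

Lemma th_pos x y : x <> y -> 0 < th x y.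
Proof.
intros Hxy.
assert (0 < d x y).
{ destruct (met_nonneg d Hd x y) as [|E]; auto.
  symmetry in E; now apply (met_zero d Hd) in E. }
destruct (sc_lt_ex (d x y / 5)) as [k Hk]; [lra|].
destruct (net_cover k x) as (v & Hv & Hvx); pose proof (sc_pos k).
pose proof (th_ge k v x y ltac:(lra) Hv ltac:(lra)).
assert (0 < eps ^ 2 * wt k v)
  by (apply Rmult_lt_0_compat; [apply pow_lt; lra | apply wt_pos]).
pose proof (pw_ge0 decay_const (/ p)); nra.
Qed.

Lemma th_metric : is_metric th.
Proof.
constructor.
- apply th_ge0.
- intros x y; split; [|intros ->; apply th_refl].
  intros H; apply NNPP; intros Hne; pose proof (th_pos x y Hne); lra.
- intros x y; apply Rle_antisym; apply Hth; intros c Hc; apply Hth; now apply cover_chain_sym.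
- intros x y z.
  enough (th x z - th x y <= th y z) by lra; apply Hth; intros c' Hc'.
  enough (th x z - c' <= th x y) by lra; apply Hth; intros c Hc.
  enough (th x z <= c + c') by lra; apply Hth; now apply cover_chain_app with y.
Qed.

Lemma eps_pow n : 0 < eps ^ n <= 1.
Proof.
split; [apply pow_lt; lra|].
pose proof (pow_incr eps 1 n ltac:(lra)) as H; now rewrite pow1 in H.
Qed.

(** Two levels below [n + 1] the scale satisfies [5 a^-(n+3) < 1/2 a^-(n+1)], so [th_ge] applies
    there; by [wt_growth] the descent from [n] costs [eps ^ 4]. *)
Lemma th_ge_level n v x z : / 2 * sc (S n) < d x z -> Xn n v -> d v x < 2 * sc n ->
  eps ^ 6 * wt n v <= (1 + D) * th x z.
Proof.
intros Hxz Hv Hvx.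
destruct (net_cover (n + 3) x) as (u & Hu & Hux).
pose proof (sc_pos (n + 3)).
eapply Rle_trans; [|apply (th_ge (n + 3) u x z); auto; [|lra]].
- replace (eps ^ 6) with (eps ^ 2 * eps ^ 4) by ring; rewrite Rmult_assoc.
  apply Rmult_le_compat_l; [apply Rlt_le, eps_pow|].
  apply wt_growth with x; auto; lra.
- replace (n + 3)%nat with (S (S (S n))) in * by lia.
  pose proof (sc_6 (S (S n))); pose proof (sc_6 (S n)); lra.
Qed.

(** * Power quasisymmetry *)

Lemma pw_sc n y : pw (sc n) y = pw (/ a) y ^ n.
Proof. rewrite <- pow_inv, pw_pow_l; auto; apply Rinv_0_lt_compat; lra. Qed.

Lemma pw_inv_a y : pw a y * pw (/ a) y = 1.
Proof.
assert (0 < / a) by (apply Rinv_0_lt_compat; lra).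
rewrite <- pw_mult, Rinv_r, pw_1 by lra; easy.
Qed.

(** Let [k] and [n] be the levels of [d x y] and [d x z]. If [n <= k], decay of the weights gives
    the power [/ al] of the ratio of distances; otherwise [wt_growth] gives the power [al]. The
    conditions on [al] turn [rate] and [eps] into powers of [a]. *)
Lemma th_upper_bound al x y z : 1 <= al -> rate <= pw (/ a) (/ al) -> pw (/ a) al <= eps ->
  z <> x -> y <> x ->
  eps ^ 6 * th x y <= (D * pw a (/ al) + pw a al ^ 2) *
    Rmax (pw (d x y / d x z) al) (pw (d x y / d x z) (/ al)) * ((1 + D) * th x z).
Proof.
intros Hal Hrate Heps' Hzx Hyx.
assert (Hpos : forall w, w <> x -> 0 < d x w <= 1 / 2).
{ intros w Hw; split; [|apply dist_le_half].
  destruct (met_nonneg d Hd x w) as [|E]; auto.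
  symmetry in E; apply (met_zero d Hd) in E; congruence. }
destruct (level_ex _ (Hpos y Hyx)) as (k & Hk1 & Hk2).
destruct (level_ex _ (Hpos z Hzx)) as (n & Hn1 & Hn2).
pose proof (Hpos z Hzx) as [Hz0 _].
set (t := d x y / d x z).
destruct (net_cover k x) as (v & Hv & Hvx); destruct (net_cover n x) as (u & Hu & Hux).
pose proof (sc_pos k); pose proof (sc_pos n).
assert (Hxy : th x y <= wt k v).
{ apply th_le; auto; [lra|]; pose proof (met_tri d Hd v x y); lra. }
pose proof (th_ge_level n u x z Hn1 Hu ltac:(lra)) as Hxz.
assert (Hal0 : 0 < / al) by (apply Rinv_0_lt_compat; lra).
pose proof (pw_ge0 decay_const (/ p)) as HD.
pose proof (pw_ge0 a (/ al)) as HA; pose proof (pw_ge0 a al) as HA'.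
pose proof (wt_pos n u) as Hwu.
assert (HF : wt k v <= (D * pw a (/ al) + pw a al ^ 2) * Rmax (pw t al) (pw t (/ al)) * wt n u).
{ assert (Hlevel : (n <= k)%nat \/ (k < n)%nat) by lia.
  destruct Hlevel as [Hnk | Hkn].
  (* Levels determine distances only up to a factor [a], whence the shift by one, paid by
     [pw a (/ al)]. *)
  - assert (Ht : sc (S (k - n)) <= t).
    { unfold t; apply Rmult_le_reg_r with (d x z); [easy|].
      unfold Rdiv; rewrite Rmult_assoc, Rinv_l, Rmult_1_r by lra.
      apply Rle_trans with (sc (S (k - n)) * (/ 2 * sc n));
        [apply Rmult_le_compat_l; [apply Rlt_le, sc_pos | easy]|].
      replace (sc (S (k - n)) * (/ 2 * sc n)) with (/ 2 * (sc (S (k - n)) * sc n)) by ring.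
      rewrite <- Rinv_mult, <- pow_add.
      replace (S (k - n) + n)%nat with (S k) by lia; lra. }
    assert (Hr : rate ^ (k - n) <= pw a (/ al) * pw t (/ al)).
    { apply Rle_trans with (pw a (/ al) * pw (sc (S (k - n))) (/ al)).
      - rewrite pw_sc; simpl; rewrite <- Rmult_assoc, pw_inv_a, Rmult_1_l.
        apply pow_incr; pose proof rate_bounds; lra.
      - apply Rmult_le_compat_l; auto; apply pw_le; lra. }
    replace k with (n + (k - n))%nat in Hv |- * by lia.
    eapply Rle_trans; [apply (wt_decay n (k - n) x u v); auto; [lra|]|].
    { pose proof (sc_decr n k Hnk); lra. }
    apply Rmult_le_compat_r; [lra|].
    pose proof (Rmax_r (pw t al) (pw t (/ al))).
    pose proof (pw_ge0 t (/ al)).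
    apply Rle_trans with (D * pw a (/ al) * pw t (/ al)).
    + rewrite Rmult_assoc; now apply Rmult_le_compat_l.
    + apply Rmult_le_compat; auto; [now apply Rmult_le_pos|].
      pose proof (pow_le (pw a al) 2 HA'); lra.
  - destruct (Nat.lt_exists_pred 0 (n - k) ltac:(lia)) as (j & Hj & _).
    assert (En : n = (k + S j)%nat) by lia.
    assert (Ht : a ^ j <= t).
    { unfold t; apply Rmult_le_reg_r with (d x z); [easy|].
      unfold Rdiv; rewrite Rmult_assoc, Rinv_l, Rmult_1_r by lra.
      apply Rle_trans with (a ^ j * (/ 2 * sc n));
        [apply Rmult_le_compat_l; [apply pow_le; lra | easy]|].
      replace (a ^ j * (/ 2 * sc n)) with (/ 2 * sc (S k)); [lra|].
      rewrite En; replace (k + S j)%nat with (S k + j)%nat by lia; rewrite pow_add.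
      field; split; apply pow_nonzero; lra. }
    rewrite En in Hu, Hux |- *.
    pose proof (wt_growth k (S j) x v u Hv ltac:(lra) Hu ltac:(rewrite <- En in *; lra)) as Hg.
    assert (HE : 1 <= pw a al * eps).
    { rewrite <- (pw_inv_a al); now apply Rmult_le_compat_l. }
    (* Growth over [j + 1] levels costs [eps ^ (j + 2)], while [t] is only known to be at least
       [a ^ j]; the excess is the factor [pw a al ^ 2]. *)
    assert (HE2 : 1 <= pw a al ^ S (S j) * eps ^ S (S j))
      by (rewrite <- Rpow_mult_distr; now apply pow_R1_Rle).
    pose proof (wt_pos k v); pose proof (wt_pos (k + S j) u).
    apply Rle_trans with (pw a al ^ S (S j) * wt (k + S j) u).
    { apply Rle_trans with (pw a al ^ S (S j) * (eps ^ S (S j) * wt k v)).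
      - rewrite <- Rmult_assoc; rewrite <- (Rmult_1_l (wt k v)) at 1.
        apply Rmult_le_compat_r; lra.
      - apply Rmult_le_compat_l; [now apply pow_le | easy]. }
    apply Rmult_le_compat_r; [lra|].
    replace (pw a al ^ S (S j)) with (pw a al ^ 2 * pw a al ^ j) by (simpl; ring).
    rewrite <- (pw_pow_l a al j) by lra.
    pose proof (Rmax_l (pw t al) (pw t (/ al))).
    pose proof (pw_le (a ^ j) t al ltac:(lra) Ht).
    apply Rmult_le_compat; [now apply pow_le | apply pw_ge0 | | lra].
    pose proof (Rmult_le_pos _ _ HD HA); lra. }
assert (HF0 : 0 <= (D * pw a (/ al) + pw a al ^ 2) * Rmax (pw t al) (pw t (/ al))).
{ apply Rmult_le_pos.
  - pose proof (Rmult_le_pos _ _ HD HA); pose proof (pow_le _ 2 HA'); lra.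
  - eapply Rle_trans; [apply (pw_ge0 t al) | apply Rmax_l]. }
apply Rle_trans with (eps ^ 6 * wt k v);
  [apply Rmult_le_compat_l; [apply Rlt_le, eps_pow | easy]|].
eapply Rle_trans; [apply Rmult_le_compat_l; [apply Rlt_le, eps_pow | exact HF]|].
rewrite <- Rmult_assoc, (Rmult_comm (eps ^ 6)), Rmult_assoc.
now apply Rmult_le_compat_l.
Qed.

Lemma exponent_ex : exists al, 1 <= al /\ rate <= pw (/ a) (/ al) /\ pw (/ a) al <= eps.
Proof.
assert (Hla : 0 < ln a) by (rewrite <- ln_1; apply ln_increasing; lra).
pose proof rate_bounds as Hr.
assert (Hlr : ln rate < 0) by (rewrite <- ln_1; apply ln_increasing; lra).
set (al := Rmax 1 (Rmax (ln a / - ln rate) (- ln eps / ln a))).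
assert (H1 : 1 <= al) by apply Rmax_l.
assert (H2 : ln a / - ln rate <= al) by (eapply Rle_trans; [apply Rmax_l | apply Rmax_r]).
assert (H3 : - ln eps / ln a <= al) by (eapply Rle_trans; [apply Rmax_r | apply Rmax_r]).
assert (Hia : 0 < / a) by (apply Rinv_0_lt_compat; lra).
assert (Hexp : forall s t, s <= t -> exp s <= exp t)
  by (intros s t [H | ->]; [apply Rlt_le; now apply exp_increasing | lra]).
exists al; split; [easy|]; rewrite !(pw_pos (/ a)) by easy; unfold Rpower.
rewrite ln_Rinv by lra; split.
- rewrite <- (exp_ln rate) by easy; apply Hexp.
  apply Rmult_le_reg_l with al; [lra|].
  rewrite <- Rmult_assoc, Rinv_r, Rmult_1_l by lra.
  apply (Rmult_le_compat_r (- ln rate)) in H2; [|lra].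
  unfold Rdiv in H2; rewrite Rmult_assoc, Rinv_l in H2; lra.
- rewrite <- (exp_ln eps) at 1 by easy; apply Hexp.
  apply (Rmult_le_compat_r (ln a)) in H3; [|lra].
  unfold Rdiv in H3; rewrite Rmult_assoc, Rinv_l in H3; lra.
Qed.

Lemma th_power_quasisymmetric : in_Jp d th.
Proof.
split; [apply th_metric|].
destruct exponent_ex as (al & Hal & Hr & He).
set (C := (D * pw a (/ al) + pw a al ^ 2) * (1 + D) * / eps ^ 6).
exists (Rmax 1 C), al; split; [apply Rmax_l|]; split; [easy|].
intros x y z Hzx; unfold eta_pow; set (t := d x y / d x z).
set (m := Rmax (pw t al) _).
assert (Hm : 0 <= m) by (eapply Rle_trans; [apply (pw_ge0 t al) | apply Rmax_l]).
destruct (classic (y = x)) as [-> | Hyx].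
- rewrite th_refl; unfold Rdiv; rewrite Rmult_0_l.
  apply Rmult_le_pos; auto; eapply Rle_trans; [|apply Rmax_l]; lra.
- apply Rle_trans with (C * m); [|apply Rmult_le_compat_r; [easy | apply Rmax_r]].
  pose proof (th_pos x z ltac:(congruence)).
  apply Rmult_le_reg_r with (th x z); [easy|].
  unfold Rdiv; rewrite Rmult_assoc, Rinv_l, Rmult_1_r by lra.
  pose proof (eps_pow 6) as He6.
  apply Rmult_le_reg_l with (eps ^ 6); [lra|].
  eapply Rle_trans; [apply (th_upper_bound al x y z); auto|].
  apply Req_le; fold t m; unfold C; field; lra.
Qed.

(** * The Assouad bound *)

Lemma th_le_wt k w y : Xn k w -> d w y < sc k -> eps * th w y <= wt k w.
Proof.
intros Hw Hwy; pose proof (wt_pos k w).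
destruct k as [|k].
- assert (th w y <= wt 0 w); [|simpl in *; pose proof (th_ge0 w y); nra].
  pose proof (dist_le_half w y).
  apply th_le; rewrite ?dist_refl; simpl in *; auto; lra.
(* [th_le] needs distances of at most half the radius, so the ball of the parent is used, at the
   cost of one [eps]. *)
- eapply Rle_trans; [|apply wt_par_ge]; apply Rmult_le_compat_l; [lra|].
  pose proof (par_near k w Hw); pose proof (sc_6 k); pose proof (sc_pos k).
  pose proof (met_tri d Hd (par w (S k)) w y).
  apply th_le; [now apply par_in | lra..].
Qed.

Lemma wt_small t : 0 < t -> exists k, forall n w, (k <= n)%nat -> Xn n w -> wt n w < t.
Proof.
intros Ht; pose proof (pw_ge0 decay_const (/ p)) as HD; pose proof rate_bounds.
destruct (pow_lt_1_zero rate) with (y := t / (1 + D)) as [k Hk].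
- rewrite Rabs_right; lra.
- apply Rdiv_lt_0_compat; lra.
- exists k; intros n w Hn Hw; specialize (Hk n Hn).
  rewrite Rabs_right in Hk by (apply Rle_ge, pow_le; lra).
  destruct (net_cover 0 w) as (v & Hv & _).
  pose proof (wt_decay 0 n w v w Hv) as H1; simpl in H1.
  pose proof (dist_le_half v w); pose proof (dist_le_half w w).
  specialize (H1 ltac:(lra) Hw ltac:(lra)); rewrite Rmult_1_r in H1.
  apply (Rmult_lt_compat_l (1 + D)) in Hk; [|lra].
  replace ((1 + D) * (t / (1 + D))) with t in Hk by (field; lra).
  assert (0 <= rate ^ n) by (apply pow_le; lra); nra.
Qed.

(** Take a level that is not [light] followed by one that is. A heavy vertex at the first confines
    the [th]-ball by [th_ge]; lightness of the second bounds the weights of the first by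
    [wt_growth]. If level 0 is light, the diameter suffices. *)
Lemma level_of_radius x RR : 0 < RR -> exists n,
  (forall y, th x y < RR -> d x y <= 5 * sc n) /\
  (forall v, Xn n v -> d v x < 2 * sc n -> eps ^ 4 * wt n v <= (1 + D) * RR).
Proof.
intros HR; pose proof (pw_ge0 decay_const (/ p)) as HD.
set (light := fun k => forall v, Xn k v -> d v x < 2 * sc k -> eps ^ 2 * wt k v < (1 + D) * RR).
assert (Hball : forall k, ~ light k -> forall y, th x y < RR -> d x y <= 5 * sc k).
{ intros k Hk y Hy; apply Rnot_lt_le; intros Hxy; apply Hk; intros v Hv Hvx.
  eapply Rle_lt_trans; [apply (th_ge k v x y); auto|]; apply Rmult_lt_compat_l; lra. }
destruct (wt_small ((1 + D) * RR)) as [n Hn]; [apply Rmult_lt_0_compat; lra|].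
destruct (nat_first light n) as [H0 | (k & _ & Hk & HSk)].
- intros v Hv _; specialize (Hn n v (le_n n) Hv).
  pose proof (eps_pow 2); pose proof (wt_pos n v); nra.
- exists 0%nat; split.
  + intros y _; pose proof (dist_le_half x y); simpl; lra.
  + intros v Hv Hvx; specialize (H0 v Hv Hvx); simpl wt in *.
    replace (eps ^ 4) with (eps ^ 2 * eps ^ 2) by ring.
    pose proof (eps_pow 2); nra.
- exists k; split; [now apply Hball|].
  intros v Hv Hvx; destruct (net_cover (S k) x) as (u & Hu & Hux).
  pose proof (sc_pos (S k)); specialize (HSk u Hu ltac:(lra)).
  replace (S k) with (k + 1)%nat in * by lia.
  pose proof (wt_growth k 1 x v u Hv Hvx Hu ltac:(lra)).
  replace (eps ^ 4) with (eps ^ 2 * eps ^ 2) by ring; rewrite Rmult_assoc.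
  apply Rle_trans with (eps ^ 2 * wt (k + 1) u); [|lra].
  apply Rmult_le_compat_l; [apply Rlt_le, eps_pow | easy].
Qed.

(** Markov's inequality for the mass of level [n + j]. *)
Lemma heavy_vertices n j x v t : 0 < t -> Xn n v -> d v x < 2 * sc n ->
  exists l, INR (length l) * pw t p <= (/ 2) ^ j * (decay_const * pw (wt n v) p) /\
    forall w, In w l <-> Xn (n + j) w /\ d w x < 20 * sc n /\ t <= wt (n + j) w.
Proof.
intros Ht Hv Hvx.
destruct (sum_ind_eq (L (n + j)) (fun w => d w x < 20 * sc n /\ t <= wt (n + j) w)
  (fun w => pw (wt (n + j) w) p)) as (l & E & _ & Hl).
exists l; split; [|intros w; rewrite Hl, in_L; tauto].
eapply Rle_trans; [|apply (mass_decay_wt n j x v Hv Hvx)].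
rewrite <- sum_const; apply Rle_trans with (sum l (fun w => pw (wt (n + j) w) p)).
- apply sum_le; intros w Hw; apply Hl in Hw; apply pw_le; lra.
- rewrite <- E; apply sum_le; intros w _; apply Rmult_le_compat_r; [apply pw_ge0|].
  apply ind_imp; tauto.
Qed.

(** The bounds on the successive levels form a geometric series, whose sum stays below 2 however
    many levels are counted. *)
Lemma heavy_vertices_upto n m x v t : 0 < t -> Xn n v -> d v x < 2 * sc n ->
  exists l, INR (length l) * pw t p <= (2 - 2 * (/ 2) ^ m) * (decay_const * pw (wt n v) p) /\
    forall j w, (j < m)%nat -> Xn (n + j) w -> d w x < 20 * sc n -> t <= wt (n + j) w -> In w l.
Proof.
intros Ht Hv Hvx; induction m as [|m (l & Hl & Hin)].
- exists nil; split; [simpl; lra | lia].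
- destruct (heavy_vertices n m x v t Ht Hv Hvx) as (l' & Hl' & Hin').
  exists (l ++ l'); split.
  + rewrite length_app, plus_INR; simpl; lra.
  + intros j w Hj Hw Hwx Hwt; apply in_app_iff.
    destruct (Nat.eq_dec j m) as [-> | Hne]; [right; apply Hin'; auto | left].
    apply Hin with j; auto; lia.
Qed.

(** Each [y] is covered from a nearby vertex of weight less than [eps * r], either on level [n],
    counted by packing, or one level below a vertex near [y] of weight at least [eps * r]. The
    latter kind weighs at least [eps ^ 3 * r] and is counted by its [p]-mass. *)
Lemma th_assouad : assouad_bound th p.
Proof.
pose proof (pw_ge0 decay_const (/ p)) as HD; pose proof decay_const_ge0 as HB.
(* [eps ^ 7] combines the [eps ^ 4] of [level_of_radius] with the [eps ^ 3] of the threshold [t]. *)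
exists (INR (N ^ 6) + 2 * decay_const * pw ((1 + D) * / eps ^ 7) p).
intros x r RR Hr HrR.
destruct (level_of_radius x RR ltac:(lra)) as (n & Hball & Hwt).
destruct (net_cover n x) as (v & Hv & Hvx).
pose proof (sc_pos n) as Hsc; specialize (Hwt v Hv ltac:(lra)).
set (t := eps ^ 3 * r).
assert (Ht : 0 < t) by (apply Rmult_lt_0_compat; [apply eps_pow | easy]).
destruct (wt_small (eps * r)) as [m Hm]; [apply Rmult_lt_0_compat; lra|].
destruct (heavy_vertices_upto n (S m) x v t Ht Hv ltac:(lra)) as (l & Hl & Hin).
destruct (sum_ind_eq (L n) (fun w => d w x < 20 * sc n) (fun _ => 1)) as (l0 & _ & Hnd & Hl0).
exists (l0 ++ l); split.
- rewrite length_app, plus_INR, <- pw_pos by (apply Rdiv_lt_0_compat; lra).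
  rewrite Rmult_plus_distr_r; apply Rplus_le_compat.
  + rewrite <- (Rmult_1_r (INR (length l0))); apply Rmult_le_compat; try apply pos_INR; [lra| |].
    * apply (net_packing_R 6 n x (20 * sc n)); [lra | apply Hnd, HL|].
      intros w Hw; apply Hl0 in Hw as [Hw Hwx]; split; auto; now apply in_L.
    * rewrite <- (pw_1 p); apply pw_le; [lra|].
      apply Rmult_le_reg_r with r; [easy|].
      unfold Rdiv; rewrite Rmult_assoc, Rinv_l; lra.
  + pose proof (pw_gt0 t p Ht).
    apply Rmult_le_reg_r with (pw t p); [easy|].
    eapply Rle_trans; [exact Hl|].
    assert (0 <= decay_const * pw (wt n v) p) by (apply Rmult_le_pos; [easy | apply pw_ge0]).
    pose proof (pow_le (/ 2) (S m) ltac:(lra)).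
    apply Rle_trans with (2 * (decay_const * pw (wt n v) p));
      [apply Rmult_le_compat_r; [easy | lra]|].
    rewrite !Rmult_assoc; apply Rmult_le_compat_l; [lra|]; apply Rmult_le_compat_l; [easy|].
    pose proof (eps_pow 7); pose proof (eps_pow 4).
    assert (0 < / eps ^ 7) by now apply Rinv_0_lt_compat.
    assert (0 < RR / r) by (apply Rdiv_lt_0_compat; lra).
    rewrite <- !pw_mult; try lra; [|apply Rmult_le_pos; lra..].
    apply pw_le; [lra|].
    apply Rmult_le_reg_l with (eps ^ 4); [lra|].
    eapply Rle_trans; [exact Hwt|]; apply Req_le; unfold t; field; lra.
- intros y Hy; specialize (Hball y Hy); rewrite (met_sym d Hd) in Hball.
  assert (Hsmall : forall k w, Xn k w -> d w y < sc k -> wt k w < eps * r -> ball th w r y).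
  { intros k w Hw Hwy Hwr; pose proof (th_le_wt k w y Hw Hwy).
    apply Rmult_lt_reg_l with eps; lra. }
  destruct (nat_first (fun j => forall w, Xn (n + j) w -> d w y < sc (n + j) ->
    wt (n + j) w < eps * r) m) as [H0 | (j & Hj & Hnj & HSj)].
  + intros w Hw _; apply Hm; auto; lia.
  + destruct (net_cover n y) as (w & Hw & Hwy).
    rewrite Nat.add_0_r in H0; specialize (H0 w Hw Hwy).
    exists w; split; [|now apply (Hsmall n)].
    apply in_app_iff; left; apply Hl0; split; [now apply in_L|].
    pose proof (met_tri d Hd w y x); lra.
  + destruct (net_cover (n + S j) y) as (w & Hw & Hwy).
    exists w; split; [|now apply (Hsmall (n + S j)%nat); auto].
    apply not_all_ex_not in Hnj as [u Hu].
    apply imply_to_and in Hu as [Hu Hu']; apply imply_to_and in Hu' as [Huy Huw].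
    apply Rnot_lt_le in Huw.
    pose proof (sc_pos (n + j)); pose proof (sc_pos (n + S j)).
    pose proof (sc_decr n (n + S j) ltac:(lia)).
    apply in_app_iff; right; apply Hin with (S j); auto; [lia | |].
    * pose proof (met_tri d Hd w y x); lra.
    * pose proof (wt_growth (n + j) 1 y u w Hu ltac:(lra)) as Hg.
      replace (n + j + 1)%nat with (n + S j)%nat in Hg by lia.
      eapply Rle_trans; [|apply Hg; auto; lra].
      unfold t; replace (eps ^ 3 * r) with (eps ^ 2 * (eps * r)) by ring.
      apply Rmult_le_compat_l; [apply Rlt_le, eps_pow | easy].
Qed.

End Theta.
End Admissible.
End Weight.
End Filling.

(** * Power gauges are homeomorphisms *)

Lemma pw_exp_le_small t y z : 0 <= t <= 1 -> y <= z -> pw t z <= pw t y.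
Proof.
intros [[Ht | <-] Ht1] Hyz; [|rewrite !(pw_nonpos 0); lra].
rewrite !pw_pos by easy; unfold Rpower.
assert (ln t <= 0) by (destruct Ht1 as [Ht1 | ->]; rewrite <- ln_1;
  [apply Rlt_le, ln_increasing | right]; easy).
destruct (Rle_lt_or_eq_dec (z * ln t) (y * ln t)) as [H1 | ->]; [nra | | lra].
now apply Rlt_le, exp_increasing.
Qed.

Lemma pw_exp_le_large t y z : 1 <= t -> y <= z -> pw t y <= pw t z.
Proof.
intros Ht [Hyz | ->]; [|lra]; rewrite !pw_pos by lra.
apply Rle_Rpower; lra.
Qed.

Lemma pw_inverse t y : 0 <= t -> y <> 0 -> pw (pw t y) (/ y) = t.
Proof. intros Ht Hy; rewrite pw_pw, Rinv_r, pw_id; easy. Qed.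

Lemma cont_pw y : 0 < y -> cont_on_nonneg (fun t => pw t y).
Proof.
intros Hy t e [Ht | <-] He.
- assert (Hder : derivable_pt (fun x => Rpower x y) t)
    by (eexists; exact (derivable_pt_lim_power t y Ht)).
  destruct (derivable_continuous_pt _ _ Hder e He) as (del & Hdel & H).
  simpl in H; unfold Rdist in H.
  exists (Rmin del t); split; [apply Rmin_pos; easy|]; intros s _ Hst.
  pose proof (Rmin_l del t); pose proof (Rmin_r del t).
  assert (0 < s) by (apply Rabs_def2 in Hst; lra).
  rewrite !pw_pos by easy.
  destruct (Req_dec s t) as [-> | Hne]; [rewrite Rminus_diag, Rabs_R0; easy|].
  apply H; split; [|lra]; split; [exact I | auto].
- exists (pw e (/ y)); split; [now apply pw_gt0|]; intros s Hs Hst.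
  rewrite Rminus_0_r, Rabs_right in Hst by lra.
  rewrite (pw_nonpos 0), Rminus_0_r, Rabs_right by (lra || apply Rle_ge, pw_ge0).
  apply (conj Hs), (pw_lt s _ y Hy) in Hst.
  rewrite pw_pw, Rinv_l, pw_id in Hst; lra.
Qed.

(** The hypothesis on [m] expresses 1-Lipschitz control in the sup norm, which the maximum and the
    minimum both satisfy. *)
Lemma cont_binary (m : R -> R -> R) f g :
  (forall x y x' y' e, Rabs (x - x') < e -> Rabs (y - y') < e -> Rabs (m x y - m x' y') < e) ->
  cont_on_nonneg f -> cont_on_nonneg g -> cont_on_nonneg (fun t => m (f t) (g t)).
Proof.
intros Hm Hf Hg t e Ht He.
destruct (Hf t e Ht He) as (d1 & H1 & Hd1); destruct (Hg t e Ht He) as (d2 & H2 & Hd2).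
exists (Rmin d1 d2); split; [now apply Rmin_pos|]; intros s Hs Hst.
pose proof (Rmin_l d1 d2); pose proof (Rmin_r d1 d2).
apply Hm; [apply Hd1 | apply Hd2]; lra.
Qed.

Lemma cont_max f g : cont_on_nonneg f -> cont_on_nonneg g ->
  cont_on_nonneg (fun t => Rmax (f t) (g t)).
Proof.
apply cont_binary; intros x y x' y' e H H'.
apply Rabs_def2 in H, H'; apply Rabs_def1; unfold Rmax;
  destruct (Rle_dec x y), (Rle_dec x' y'); lra.
Qed.

Lemma cont_min f g : cont_on_nonneg f -> cont_on_nonneg g ->
  cont_on_nonneg (fun t => Rmin (f t) (g t)).
Proof.
apply cont_binary; intros x y x' y' e H H'.
apply Rabs_def2 in H, H'; apply Rabs_def1; unfold Rmin;
  destruct (Rle_dec x y), (Rle_dec x' y'); lra.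
Qed.

Lemma cont_scal_r c f : 0 < c -> cont_on_nonneg f -> cont_on_nonneg (fun t => c * f t).
Proof.
intros Hc Hf t e Ht He.
destruct (Hf t (e / c) Ht) as (del & Hdel & H); [now apply Rdiv_lt_0_compat|].
exists del; split; auto; intros s Hs Hst; specialize (H s Hs Hst).
rewrite <- Rmult_minus_distr_l, Rabs_mult, (Rabs_right c) by lra.
apply (Rmult_lt_compat_l c) in H; auto.
replace (c * (e / c)) with e in H by (field; lra); easy.
Qed.

Lemma cont_scal_arg c f : 0 < c -> cont_on_nonneg f -> cont_on_nonneg (fun t => f (t / c)).
Proof.
intros Hc Hf t e Ht He.
assert (Hdiv : forall s, 0 <= s -> 0 <= s / c)
  by (intros; apply Rmult_le_pos; auto; apply Rlt_le; now apply Rinv_0_lt_compat).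
destruct (Hf (t / c) e (Hdiv t Ht) He) as (del & Hdel & H).
exists (c * del); split; [now apply Rmult_lt_0_compat|]; intros s Hs Hst.
apply H; auto.
replace (s / c - t / c) with ((s - t) * / c) by (field; lra).
pose proof (Rinv_0_lt_compat c Hc).
rewrite Rabs_mult, (Rabs_right (/ c)) by lra.
apply (Rmult_lt_compat_r (/ c)) in Hst; auto.
replace (c * del * / c) with del in Hst by (field; lra); easy.
Qed.

(** The maximum of the powers [al] and [/ al] is inverted by their minimum: on either side of 1 the
    two select mutually inverse powers. *)
Lemma homeo_eta_pow C al : 1 <= C -> 1 <= al -> homeo_nonneg (eta_pow C al).
Proof.
intros HC Hal.
assert (Hi : 0 < / al <= al).
{ split; [apply Rinv_0_lt_compat; lra|].
  assert (/ al <= / 1) by (apply Rinv_le_contravar; lra); rewrite Rinv_1 in *; lra. }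
assert (Hii : / / al = al) by apply Rinv_inv.
assert (Hle1 : forall t y, 0 < y -> 0 <= t <= 1 -> 0 <= pw t y <= 1).
{ intros t y Hy Ht; split; [apply pw_ge0|]; rewrite <- (pw_1 y); apply pw_le; lra. }
assert (Hge1 : forall t y, 0 < y -> 1 <= t -> 1 <= pw t y).
{ intros t y Hy Ht; rewrite <- (pw_1 y); apply pw_le; lra. }
set (hi := fun t => Rmax (pw t al) (pw t (/ al))).
set (lo := fun t => Rmin (pw t al) (pw t (/ al))).
assert (Hhi : forall t, 0 <= t ->
  t <= 1 /\ hi t = pw t (/ al) /\ lo t = pw t al \/ 1 <= t /\ hi t = pw t al /\ lo t = pw t (/ al)).
{ intros t Ht; unfold hi, lo; destruct (Rle_dec t 1) as [Ht1 | Ht1]; [left | right].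
  - pose proof (pw_exp_le_small t (/ al) al ltac:(lra) ltac:(lra)).
    rewrite Rmax_right, Rmin_left by easy; easy.
  - pose proof (pw_exp_le_large t (/ al) al ltac:(lra) ltac:(lra)).
    rewrite Rmax_left, Rmin_right by easy; lra. }
assert (Hhi0 : forall t, 0 <= hi t).
{ intros t; unfold hi; eapply Rle_trans; [apply (pw_ge0 t al) | apply Rmax_l]. }
assert (Hlo0 : forall t, 0 <= lo t) by (intros t; apply Rmin_glb; apply pw_ge0).
assert (Hlohi : forall t, 0 <= t -> lo (hi t) = t).
{ intros t Ht; destruct (Hhi t Ht) as [(H1 & E & _) | (H1 & E & _)].
  - pose proof (Hle1 t (/ al) ltac:(lra) ltac:(lra)); rewrite E.
    assert (Hu : 0 <= pw t (/ al)) by lra.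
    destruct (Hhi _ Hu) as [(_ & _ & ->) | (H2 & _ & ->)].
    + rewrite <- Hii at 2; apply pw_inverse; lra.
    + replace (pw t (/ al)) with 1 by lra; rewrite pw_1.
      rewrite <- (pw_inverse t (/ al)) by lra; replace (pw t (/ al)) with 1 by lra.
      now rewrite pw_1.
  - pose proof (Hge1 t al ltac:(lra) H1); rewrite E.
    assert (Hu : 0 <= pw t al) by lra.
    destruct (Hhi _ Hu) as [(H2 & _ & ->) | (_ & _ & ->)].
    + replace (pw t al) with 1 by lra; rewrite pw_1.
      rewrite <- (pw_inverse t al) by lra; replace (pw t al) with 1 by lra.
      now rewrite pw_1.
    + apply pw_inverse; lra. }
assert (Hhilo : forall t, 0 <= t -> hi (lo t) = t).
{ intros t Ht; destruct (Hhi t Ht) as [(H1 & _ & E) | (H1 & _ & E)].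
  - pose proof (Hle1 t al ltac:(lra) ltac:(lra)); rewrite E.
    assert (Hu : 0 <= pw t al) by lra.
    destruct (Hhi _ Hu) as [(_ & -> & _) | (H2 & -> & _)].
    + apply pw_inverse; lra.
    + replace (pw t al) with 1 by lra; rewrite pw_1.
      rewrite <- (pw_inverse t al) by lra; replace (pw t al) with 1 by lra.
      now rewrite pw_1.
  - pose proof (Hge1 t (/ al) ltac:(lra) H1); rewrite E.
    assert (Hu : 0 <= pw t (/ al)) by lra.
    destruct (Hhi _ Hu) as [(H2 & -> & _) | (_ & -> & _)].
    + replace (pw t (/ al)) with 1 by lra; rewrite pw_1.
      rewrite <- (pw_inverse t (/ al)) by lra; replace (pw t (/ al)) with 1 by lra.
      now rewrite pw_1.
    + rewrite <- Hii at 2; apply pw_inverse; lra. }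
assert (HdivC : forall s, 0 <= s -> 0 <= s / C).
{ intros; apply Rmult_le_pos; auto; apply Rlt_le, Rinv_0_lt_compat; lra. }
exists (fun s => lo (s / C)); unfold eta_pow.
repeat split.
- intros t _; apply Rmult_le_pos; [lra | apply Hhi0].
- intros; apply Hlo0.
- intros t Ht; fold (hi t); replace (C * hi t / C) with (hi t) by (field; lra); auto.
- intros s Hs; fold (hi (lo (s / C))); rewrite Hhilo by auto; field; lra.
- apply cont_scal_r; [lra|]; apply cont_max; apply cont_pw; lra.
- apply (cont_scal_arg C lo); [lra|]; apply cont_min; apply cont_pw; lra.
Qed.

Lemma in_Jp_in_J {X : Type} (d th : X -> X -> R) : in_Jp d th -> in_J d th.
Proof.
intros (Hm & C & al & HC & Hal & H); split; auto.
exists (eta_pow C al); split; auto; now apply homeo_eta_pow.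
Qed.

(** * Choice of the constants and conclusion *)

Lemma small_base_ex p B : 0 < p -> 0 <= B -> exists eps, 0 < eps <= 1 /\ pw eps p * B <= 1 / 4.
Proof.
intros Hp HB; set (s := / (4 * (1 + B))).
assert (Hs : s * (4 * (1 + B)) = 1) by (apply Rinv_l; lra).
assert (H0 : 0 < s) by (apply Rinv_0_lt_compat; lra).
assert (Hip : 0 < / p) by now apply Rinv_0_lt_compat.
exists (pw s (/ p)); split; [split; [now apply pw_gt0|]|].
- rewrite <- (pw_1 (/ p)); apply pw_le; nra.
- rewrite pw_pw, Rinv_l, pw_id by lra; nra.
Qed.

Theorem theorem3p4 (p lam : R) (N : nat) :
  0 < p -> 6 <= lam ->
  exists eta0 : R, 0 < eta0 < 1 /\
    forall (X : Type) (d : X -> X -> R) (a : R) (Xn : nat -> X -> Prop)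
      (par : X -> nat -> X) (sigma : X -> nat -> R),
      is_metric d -> compact_metric d -> doubling_with d N ->
      diam_eq d (1 / 2) -> lam <= a ->
      hyperbolic_filling d a Xn par ->
      (forall n x, Xn n x -> 0 <= sigma x n) ->
      S1_cond d a lam Xn sigma ->
      S2_cond Xn par sigma p eta0 ->
      (exists th : X -> X -> R, in_Jp d th /\ in_J d th /\ assouad_le th p) /\
      dimCA_le d p /\ infJp_le d p.
Proof.
intros Hp Hlam.
pose proof (pos_INR (N ^ 4)) as HN4.
(* Chosen so that [N ^ 4 * eta0 <= 1 / 8], as [near_sigma] requires; the added 1 keeps the
   denominator positive when [N = 0]. *)
set (eta0 := / (8 * (1 + INR (N ^ 4)))).
assert (Heta : eta0 * (8 * (1 + INR (N ^ 4))) = 1) by (apply Rinv_l; lra).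
assert (Heta0 : 0 < eta0) by (apply Rinv_0_lt_compat; lra).
exists eta0; split; [split; [easy | nra]|].
intros X d a Xn par sigma Hd _ HN Hdiam Ha HX Hsig HS1 HS2.
(* With [a] now fixed, [J] is chosen from [a], then [eps] from [J]. *)
destruct (Pow_x_infinity 2 ltac:(rewrite Rabs_right; lra) (4 * a)) as [J HJ].
specialize (HJ J (le_n J)); rewrite Rabs_right in HJ by (apply Rle_ge, pow_le; lra).
apply Rge_le in HJ.
destruct (small_base_ex p (INR (N ^ J)) Hp (pos_INR _)) as (eps & Heps & HepsJ).
destruct (net_enum Hd HN Hdiam Hlam Ha HX) as [L HL].
assert (Heta1 : 0 <= eta0 < 1) by (split; nra).
assert (Heta8 : INR (N ^ 4) * eta0 <= 1 / 8) by nra.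
destruct (cover_chain_inf Hd Hdiam Hlam Ha HX (sigma := sigma) (eps := eps) (L := L))
  as [th Hth]; auto.
pose proof (th_power_quasisymmetric Hd HN Hdiam Hlam Ha HX Hp Hsig HS2 Heta1 Heta8
  HL Heps HJ HepsJ HS1 Hth) as HJp.
pose proof (th_assouad Hd HN Hdiam Hlam Ha HX Hp Hsig HS2 Heta1 Heta8
  HL Heps HJ HepsJ HS1 Hth) as HA.
pose proof (in_Jp_in_J d th HJp) as HinJ.
assert (Hlt : forall e, 0 < e -> exists beta, beta < p + e /\ assouad_bound th beta)
  by (intros e He; exists p; split; [lra | easy]).
split; [exists th; auto|]; split; intros e He; exists th; auto.
Qed.
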